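(* Let $F_\nu(x)=\nu x(1-x)$, $x\in[0,1]$, with $\nu>4$; then $F_\nu$ has an invariant Cantor set $\Lambda_\nu$. Let $W_\beta(\hat x)=\sum_{i\ge0}\beta^iU(x_{-i})$, $\beta\in(0,1)$, be the utility function with $$U(x)=\frac{\min\{1,x\}^{1-\sigma}}{1-\sigma}+\frac{(2-\min\{1,x\})^{1-\gamma}}{1-\gamma},\quad x\in(0,1),$$ for some $\sigma>0$, $\gamma>0$, $\sigma\neq 1$, $\gamma\ne1$. Then $$\int_{\hat\Lambda_\nu}W_\beta\,d\hat\mu_0=\frac{1}{1-\beta}\int_{\Sigma_2^+}U\circ h_\nu^{-1}\,d\mu_{\frac12,\frac12},$$ where $\hat\mu_0$ is the measure of maximal entropy on $\hat\Lambda_\nu$, $\mu_{\frac12,\frac12}$ is the measure of maximal entropy on $\Sigma_2^+$, and $h_\nu:\Lambda_\nu\to\Sigma_2^+$ is the itinerary map.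
   Context: $\Lambda_\nu=\bigcap_{n\ge0}F_\nu^{-n}([0,1])$ (points of $[0,1]$ all of whose forward iterates stay in $[0,1]$). Its inverse limit is $\hat\Lambda_\nu=\{\hat x=(x,x_{-1},x_{-2},\ldots):\ x_{-i}\in\Lambda_\nu,\ F_\nu(x_{-i})=x_{-i+1},\ i\ge1\}$ (with $x_0=x$), with shift $\hat F_\nu(x,x_{-1},\ldots)=(F_\nu(x),x,x_{-1},\ldots)$; $\hat\mu_0$ is the $\hat F_\nu$-invariant Borel probability measure of maximal entropy. $\Sigma_2^+$ is the compact space of one-sided infinite sequences $(i_0,i_1,\ldots)$ with $i_j\in\{1,2\}$, with the shift $\sigma_2(i_0,i_1,\ldots)=(i_1,i_2,\ldots)$; $\mu_{\frac12,\frac12}$ is its measure of maximal entropy (the Bernoulli measure giving mass $2^{-k}$ to every cylinder of length $k$). One has $F_\nu^{-1}([0,1])=I_1\cup I_2$ with disjoint intervals $I_1,I_2\subset [0,1]$, and the itinerary map is $h_\nu(x)=(j_0,j_1,\ldots)$ with $F_\nu^k(x)\in I_{j_k}$, $k\ge0$; it is a homeomorphism conjugating $F_\nu|_{\Lambda_\nu}$ to $\sigma_2$. Since $U$ is given only on $(0,1)$ while $0,1\in\Lambda_\nu$, the integrals are taken over the points where the integrands are defined (i.e. the points at which $U$ is evaluated lie in $(0,1)$), and, since $U$ is bounded above, $W_\beta$ and the integrals are understood with values in $[-\infty,\infty)$. *)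

(* Defs.v *)
From HB Require Import structures.
From mathcomp Require Import all_boot all_order all_algebra.
From mathcomp Require Import all_classical all_reals all_analysis.

Set Implicit Arguments.
Unset Strict Implicit.
Unset Printing Implicit Defensive.

Import Order.TTheory GRing.Theory Num.Theory.
Import numFieldNormedType.Exports.

Local Open Scope classical_set_scope.
Local Open Scope ring_scope.

Notation borel T := (g_sigma_algebraType (@open T)).

Definition measurable_partition (d : measure_display) (T : measurableType d)
    (k : nat) (P : 'I_k -> set T) : Prop :=
  [/\ forall i, measurable (P i), trivIset setT P & \bigcup_i P i = setT].

(* The atoms of the join of P, f^-1 P, ..., f^-(n-1) P, indexed by the words
   of length n over the labels of P; some of them may be empty. *)
Definition join_atom (T : Type) (f : T -> T) (k : nat) (P : 'I_k -> set T)
    (n : nat) (w : {ffun 'I_n -> 'I_k}) : set T :=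
  \bigcap_(i : 'I_n) (iter i f @^-1` P (w i)).

(* ln 0 = 0 in the library, so null atoms contribute 0. *)
Definition shannon_entropy (d : measure_display) (T : measurableType d)
    (R : realType) (mu : probability T R) (I : finType) (Q : I -> set T) : R :=
  - \sum_(i : I) fine (mu (Q i)) * ln (fine (mu (Q i))).

(* For f-invariant mu the limit exists by subadditivity. *)
Definition entropy_wrt (d : measure_display) (T : measurableType d)
    (R : realType) (mu : probability T R) (f : T -> T)
    (k : nat) (P : 'I_k -> set T) : R :=
  limn (fun n => shannon_entropy mu (@join_atom T f k P n) / n%:R).

Definition entropy (d : measure_display) (T : measurableType d)
    (R : realType) (mu : probability T R) (f : T -> T) : \bar R :=
  ereal_sup [set h | exists (k : nat) (P : 'I_k -> set T),
    measurable_partition P /\ h = (entropy_wrt mu f P)%:E].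

Definition invariant_measure (d : measure_display) (T : measurableType d)
    (R : realType) (mu : probability T R) (f : T -> T) : Prop :=
  forall A, measurable A -> mu (f @^-1` A) = mu A.

Definition maximal_entropy_measure (d : measure_display)
    (T : measurableType d) (R : realType) (mu : probability T R)
    (f : T -> T) : Prop :=
  invariant_measure mu f /\
  forall m : probability T R, invariant_measure m f ->
    (entropy m f <= entropy mu f)%E.

Definition logistic (R : realType) (nu x : R) : R := nu * x * (1 - x).

(* logistic is defined on the whole line, but the term n = 0 of the
   intersection is [0, 1]. *)
Definition Lambda (R : realType) (nu : R) : set R :=
  \bigcap_n (iter n (logistic nu) @^-1` `[0, 1]).

(* x i stands for x_{-i}. *)
Definition inv_limit (R : realType) (nu : R) : set {ptws nat -> R} :=
  [set x | (forall i, Lambda nu (x i)) /\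
           (forall i, logistic nu (x i.+1) = x i)].

Lemma logistic_Lambda (R : realType) (nu x : R) :
  Lambda nu x -> Lambda nu (logistic nu x).
Proof. by move=> Lx n _; have := Lx n.+1 I; rewrite /preimage /= -iterS iterSr. Qed.

Lemma inv_limit0 (R : realType) (nu : R) :
  (fun=> 0 : R) \in inv_limit nu.
Proof.
have l0 : logistic nu 0 = 0 by rewrite /logistic mulr0 mul0r.
rewrite inE; split=> [i|i]; last exact: l0.
move=> n _ /=; suff -> : iter n (logistic nu) 0 = 0.
  by rewrite in_itv /= lexx ler01.
by elim: n => //= n ->.
Qed.

Definition shift_ext (R : realType) (nu : R) (x : nat -> R) : nat -> R :=
  fun i => if i is j.+1 then x j else logistic nu (x 0%N).

Lemma shift_ext_inv_limit (R : realType) (nu : R) (x : inv_limit nu) :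
  shift_ext nu (val x) \in inv_limit nu.
Proof.
have [Lx Fx] : inv_limit nu (val x) := set_valP x.
rewrite inE; split=> -[|i]; [exact: logistic_Lambda|exact: Lx|by []|exact: Fx].
Qed.

(* A pointed copy of the subspace, as required of measurable types. *)
Definition hLambda (R : realType) (nu : R) : Type := inv_limit nu.

HB.instance Definition _ (R : realType) (nu : R) :=
  Topological.copy (hLambda nu) (set_type (inv_limit nu)).
HB.instance Definition _ (R : realType) (nu : R) :=
  isPointed.Build (hLambda nu)
    (SigSub (inv_limit0 nu)).

Definition hcoord (R : realType) (nu : R) (x : hLambda nu) (i : nat) : R :=
  val x i.

Definition hshift (R : realType) (nu : R) (x : hLambda nu) : hLambda nu :=
  SigSub (shift_ext_inv_limit x).

(* The symbols 1 and 2 of Sigma_2^+ are false and true. *)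
Definition shift2 (s : cantor_space) : cantor_space := fun k => s k.+1.

Definition branch_intervals (R : realType) (nu : R) (J : bool -> set R)
    : Prop :=
  [/\ forall b, is_interval (J b), J false `&` J true = set0 &
      `[0, 1] `&` logistic nu @^-1` `[0, 1] = J false `|` J true].

(* On Lambda every iterate lies in exactly one of J false, J true. *)
Definition itinerary (R : realType) (nu : R) (J : bool -> set R) (x : R)
    : cantor_space :=
  fun k => iter k (logistic nu) x \in J true.

Definition itinerary_inv (R : realType) (nu : R) (J : bool -> set R)
    : cantor_space -> R :=
  pinv (Lambda nu) (itinerary nu J).

Definition U (R : realType) (sigma gamma x : R) : R :=
  Num.min 1 x `^ (1 - sigma) / (1 - sigma) +
  (2 - Num.min 1 x) `^ (1 - gamma) / (1 - gamma).

(* As U is bounded above on (0, 1), the partial sums have a limit in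
   [-oo, +oo). *)
Definition W (R : realType) (nu beta sigma gamma : R) (x : hLambda nu)
    : \bar R :=
  (\sum_(0 <= i <oo) (beta ^+ i * U sigma gamma (hcoord x i))%:E)%E.

(* Main.v *)
Require Import Defs.
From HB Require Import structures.
From mathcomp Require Import all_boot all_order all_algebra.
From mathcomp Require Import all_classical all_reals all_analysis.
From mathcomp Require Import measurable_realfun ring lra zify.

Set Implicit Arguments.
Unset Strict Implicit.
Unset Printing Implicit Defensive.

Import Order.TTheory GRing.Theory Num.Theory.
Import numFieldNormedType.Exports.

Local Open Scope classical_set_scope.
Local Open Scope ring_scope.

(** Since [U] is bounded above by a constant [C] on (0, 1), both integrands
    are a constant minus a nonnegative measurable function. The identity then
    reduces to a statement about laws: the coordinates [x_{-i}] all have, under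
    [mu0], the law that [itinerary_inv] has under [mu]. Granting this, every
    term of the series defining [W] contributes [beta ^+ i] times the same
    integral, the nonnegative part is summed by monotone convergence, and the
    geometric series gives the factor [(1 - beta)^-1] ([integral_W]). The points with a coordinate outside
    (0, 1) cause no trouble: 0 and 1 are mapped to 0, so if [x_0] lies in (0, 1)
    all [x_{-i}] do, and by invariance the two conditions have equal mass.

    The coordinates have the same law because [mu0] is invariant
    ([law_hcoord]). To compare [x_0] with [itinerary_inv] it is enough that the
    itinerary of [x_0] has, under [mu0], the law [mu]: that both are the fair
    coin measure ([law_itinerary_inv]). This is the uniqueness of the measure
    of maximal entropy, for the one-sided 2-shift and for the inverse limit,
    which is a two-sided 2-shift. It is proved once, for a map on a space coded
    by binary symbols that the map translates ([maximal_entropy_uniform]):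

    - the fair coin measure, a pushforward of the uniform law on [0, 1] under
      binary expansion, has entropy at least [ln 2] ([fair_entropy]), so a
      maximal measure has entropy at least [ln 2];
    - the entropy of any invariant measure is at most the Shannon entropy of
      the words of length [N] in the coding symbols, divided by [N], for each
      [N] ([entropy_le_block]);
    - so these words, of which there are [2 ^ N], have entropy at least
      [N * ln 2 = ln (2 ^ N)], and by the equality case of the Gibbs inequality
      they are equally likely.

    The second point carries the weight of the Kolmogorov-Sinai theorem. It is
    derived without conditional entropy, from one application of the Gibbs
    inequality ([entropy_name_le]): a labelling [Y] is approximated by a
    function of finitely many symbols, and the joint law of a long [Y]-name and of the symbols behind it
    is compared with the reference law under which consecutive blocks of [N]
    symbols are independent, each with its true law, and every label is the
    decoded one up to a small independent noise.

    The coding of [Lambda nu] must be injective for every [nu > 4], although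
    the derivative of the logistic map may be less than 1 in modulus on its
    branches. In the coordinate [acos (1 - 2 * x)], which turns the case
    [nu = 4] into the tent map of slope 2, the inverse branches at least halve
    distances ([logistic_contraction]), so that points with a common itinerary
    of length [n] are within [2^-1 ^+ n * pi] of each other ([agree_dist]).
    Injectivity, continuity and measurability of the coding, and the Cantor
    property of [Lambda nu], follow from this. *)

(** * Laws and Shannon entropy of finite-valued maps *)

Section finite_valued.
Context (d : measure_display) (T : measurableType d) (R : realType).
Variable mu : probability T R.

Definition finite_rv (I : finType) (X : T -> I) : Prop :=
  forall i, measurable (X @^-1` [set i]).

Definition law (I : finType) (X : T -> I) (i : I) : R :=
  fine (mu (X @^-1` [set i])).

Lemma finite_rv_preimage (I : finType) (X : T -> I) (D : set I) :
  finite_rv X -> measurable (X @^-1` D).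
Proof.
move=> mX; rewrite [X in measurable X](_ : _ = \bigcup_(i in D) (X @^-1` [set i])).
  by apply: fin_bigcup_measurable => // i _; exact: mX.
by apply/seteqP; split=> [x Dx|x [i Di /= ->]] //; exists (X x).
Qed.

Lemma finite_rv_pair (I J : finType) (X : T -> I) (Y : T -> J) :
  finite_rv X -> finite_rv Y -> finite_rv (fun x => (X x, Y x)).
Proof.
move=> mX mY [i j].
rewrite [X in measurable X](_ : _ = (X @^-1` [set i]) `&` (Y @^-1` [set j])).
  exact: measurableI.
by apply/seteqP; split=> [x [<- <-]|x [/= -> ->]].
Qed.

Lemma finite_rv_ffun (K I : finType) (X : K -> T -> I) :
  (forall k, finite_rv (X k)) -> finite_rv (fun x => [ffun k => X k x]).
Proof.
move=> mX w.
rewrite [X in measurable X](_ : _ = \bigcap_(k in [set: K]) (X k @^-1` [set w k])).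
  by apply: fin_bigcap_measurable => // k _; exact: mX.
apply/seteqP; split=> [x /= <- k _|x Xw]; first by rewrite /preimage /= ffunE.
by apply/ffunP => k; rewrite ffunE; exact: Xw.
Qed.

Lemma law_ge0 (I : finType) (X : T -> I) i : 0 <= law X i.
Proof. exact/fine_ge0/measure_ge0. Qed.

Lemma prob_finite_rv (I : finType) (X : T -> I) (e : pred I) : finite_rv X ->
  fine (mu (X @^-1` [set i | e i])) = \sum_(i | e i) law X i.
Proof.
move=> mX.
have -> : X @^-1` [set i | e i] =
    \bigcup_(i in [set i | e i]) (X @^-1` [set i]).
  by apply/seteqP; split=> [x ex|x [i Di /= ->]] //; exists (X x).
rewrite measure_fin_bigcup//; last by apply/trivIsetP => i j _ _; apply: contra_neqP;
  move=> /eqP/set0P[x [/= <- <-]].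
rewrite -(@bigfs _ _ _ _ (index_enum I)) ?index_enum_uniq// => [|i _]; last by rewrite mem_index_enum.
  by rewrite -sum_fine// => i _; apply: fin_num_measure.
exact: finite_finset.
Qed.

Lemma law_comp (I J : finType) (g : I -> J) (X : T -> I) j : finite_rv X ->
  law (g \o X) j = \sum_(i | g i == j) law X i.
Proof.
move=> mX; rewrite -prob_finite_rv//; congr (fine (mu _)).
by apply/seteqP; split=> x /eqP.
Qed.

Lemma law_comp_ge (I J : finType) (g : I -> J) (X : T -> I) i : finite_rv X ->
  law X i <= law (g \o X) (g i).
Proof.
move=> mX; rewrite law_comp// (bigD1 i)//= lerDl sumr_ge0// => *.
exact: law_ge0.
Qed.

Lemma law_sum1 (I : finType) (X : T -> I) : finite_rv X ->
  \sum_i law X i = 1.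
Proof.
move=> mX; rewrite -[LHS](prob_finite_rv xpredT)//.
by rewrite [X in mu X](_ : _ = setT) ?probability_setT//; exact/seteqP.
Qed.

Lemma law_sum_comp (I J : finType) (g : I -> J) (X : T -> I) (phi : J -> R) :
  finite_rv X ->
  \sum_j law (g \o X) j * phi j = \sum_i law X i * phi (g i).
Proof.
move=> mX; rewrite [RHS](partition_big g xpredT)//=; apply: eq_bigr => j _.
by rewrite law_comp// mulr_suml; apply: eq_bigr => i /eqP ->.
Qed.

Local Notation entropy_of X := (shannon_entropy mu (fun i => X @^-1` [set i])).

(** The summand form of [ln x <= x - 1]; the last hypothesis is absolute
    continuity, necessary because [ln 0 = 0] here. *)
Lemma gibbs_term (p q : R) : 0 <= p -> 0 <= q -> (0 < p -> 0 < q) ->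
  - (p * ln p) <= - (p * ln q) + (q - p).
Proof.
rewrite le_eqVlt => /predU1P[<- q0 _|p0 _ /(_ p0) q0].
  by rewrite !mul0r oppr0 add0r addr0.
have qp0 : 0 < q / p by rewrite divr_gt0.
have := expR_ge1Dx (ln (q / p)); rewrite lnK ?posrE// ln_div ?posrE//.
rewrite -(ler_pM2l p0) mulrCA divff ?gt_eqF// mulr1; lra.
Qed.

Lemma gibbs_term_eq (p q : R) : 0 <= p -> 0 < q ->
  - (p * ln q) + (q - p) <= - (p * ln p) -> p = q.
Proof.
rewrite le_eqVlt => /predU1P[<- q0|p0 q0].
  by rewrite !mul0r oppr0 add0r addr0 => q0'; apply/eqP; rewrite eq_le ltW.
have qp0 : 0 < q / p by rewrite divr_gt0.
move=> h; apply: ln_inj; rewrite ?posrE//; apply/eqP; rewrite eq_sym -subr_eq0.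
apply: contraT => ne0; have := expR_gt1Dx ne0.
rewrite -ln_div ?posrE// lnK ?posrE//.
rewrite -(ltr_pM2l p0) mulrCA divff ?gt_eqF// mulr1 ln_div ?posrE//; lra.
Qed.

(** [q] may be any subprobability: a convenient reference law gives an upper
    bound for the entropy. *)
Lemma gibbs (I : finType) (X : T -> I) (q : I -> R) : finite_rv X ->
  (forall i, 0 <= q i) -> \sum_i q i <= 1 ->
  (forall i, 0 < law X i -> 0 < q i) ->
  entropy_of X <= - \sum_i law X i * ln (q i).
Proof.
move=> mX q0 q1 pq; rewrite -[leRHS]addr0 /shannon_entropy.
apply: (@le_trans _ _ (- (\sum_i law X i * ln (q i)) +
                       \sum_i (q i - law X i))).
  rewrite -!sumrN -big_split/=; apply: ler_sum => i _.
  by apply: gibbs_term => //; [exact: law_ge0|exact: pq].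
by rewrite lerD2l sumrB law_sum1// subr_le0.
Qed.

(** The equality case of [gibbs] for the uniform reference law: the summand
    inequalities are all tight, and each forces [law X i] to be the uniform
    weight. *)
Lemma entropy_max_uniform (I : finType) (X : T -> I) : finite_rv X ->
  ln #|I|%:R <= entropy_of X -> forall i, law X i = #|I|%:R^-1.
Proof.
move=> mX hX i.
have I0 : 0 < #|I|%:R :> R by rewrite ltr0n; apply/card_gt0P; exists i.
pose u := #|I|%:R^-1 : R.
have u0 : 0 < u by rewrite invr_gt0.
have term j : 0 <= - (law X j * ln u) + (u - law X j) + law X j * ln (law X j).
  have := @gibbs_term (law X j) u (law_ge0 _ _) (ltW u0) (fun=> u0); lra.
have sum0 : \sum_j (- (law X j * ln u) + (u - law X j)
                     + law X j * ln (law X j)) <= 0.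
  rewrite !big_split/= sumrN -mulr_suml sumrN law_sum1// sumr_const.
  rewrite -[X in X - 1]mulr_natl divff ?gt_eqF// subrr addr0 mul1r.
  rewrite lnV ?posrE// opprK; move: hX; rewrite /shannon_entropy -/(law X _); lra.
rewrite -/u; apply: gibbs_term_eq => //; first exact: law_ge0.
have := sum0; rewrite (bigD1 i)//=.
have := @sumr_ge0 R I (index_enum I) (fun j => j != i) _ (fun j _ => term j).
set S := (\sum_(_ | _) _) => S0; lra.
Qed.

Lemma entropy_comp_le (I J : finType) (g : I -> J) (X : T -> I) :
  finite_rv X -> entropy_of (g \o X) <= entropy_of X.
Proof.
move=> mX; rewrite /shannon_entropy lerN2.
have := law_sum_comp g (fun j => ln (law (g \o X) j)) mX.
rewrite /law => ->; apply: ler_sum => i _; rewrite -!/(law _ _).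
have [p0|] := ltrP 0 (law X i); last first.
  move=> p0; have -> : law X i = 0 by apply/eqP; rewrite eq_le p0 law_ge0.
  by rewrite !mul0r.
rewrite ler_wpM2l ?(ltW p0)// ler_ln ?posrE ?law_comp_ge//.
exact: lt_le_trans (law_comp_ge _ _ _).
Qed.

End finite_valued.

(** * Entropy of an invariant measure bounded by block entropy *)

Definition name (T I : Type) (f : T -> T) (Y : T -> I) (n : nat) (x : T) :
    {ffun 'I_n -> I} :=
  [ffun i : 'I_n => Y (iter i f x)].

Section entropy_of_names.
Context (d : measure_display) (T : measurableType d) (R : realType).
Variables (mu : probability T R) (f : T -> T).
Hypotheses (mf : measurable_fun setT f) (invf : invariant_measure mu f).

Local Notation entropy_of X := (shannon_entropy mu (fun i => X @^-1` [set i])).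

Lemma measurable_iter n : measurable_fun setT (iter n f).
Proof.
elim: n => [|n IH]; first exact: measurable_id.
by rewrite (_ : iter n.+1 f = f \o iter n f)//; exact: measurableT_comp.
Qed.

Lemma invariant_iter n A : measurable A -> mu (iter n f @^-1` A) = mu A.
Proof.
move=> mA; elim: n => //= n <-; rewrite -[RHS]invf.
  by congr (mu _); apply/seteqP; split=> x; rewrite /preimage/= -iterS iterSr.
by rewrite -[X in measurable X]setTI; exact: (measurable_iter n measurableT mA).
Qed.

Lemma finite_rv_iter (I : finType) (Y : T -> I) n :
  finite_rv Y -> finite_rv (Y \o iter n f).
Proof.
move=> mY i; rewrite -[X in measurable X]setTI.
exact: (measurable_iter n measurableT (mY i)).
Qed.

Lemma finite_rv_name (I : finType) (Y : T -> I) n :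
  finite_rv Y -> finite_rv (name f Y n).
Proof. by move=> mY; apply: finite_rv_ffun => k; exact: finite_rv_iter. Qed.

Lemma law_iter (I : finType) (Y : T -> I) n i :
  finite_rv Y -> law mu (Y \o iter n f) i = law mu Y i.
Proof. by move=> mY; rewrite /law comp_preimage invariant_iter. Qed.

Lemma ln_prod (I : finType) (F : I -> R) : (forall i, 0 < F i) ->
  ln (\prod_i F i) = \sum_i ln (F i).
Proof.
move=> F0; suff [] : 0 < \prod_i F i /\ ln (\prod_i F i) = \sum_i ln (F i) by [].
elim/big_rec2: _ => [|i y1 y2 _ [y0 <-]]; first by rewrite ln1.
by rewrite mulr_gt0// lnM ?posrE.
Qed.

(** Keeps the label [c] with probability [1 - del] and otherwise draws it
    uniformly. Being positive on all labels, it is an admissible reference law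
    in [gibbs] whatever the decoding errors are; an error costs
    [- ln (del / #|I|)], a correct label almost nothing. *)
Definition noisy (I : finType) (del : R) (c a : I) : R :=
  (1 - del) * (a == c)%:R + del / #|I|%:R.

Lemma noisy_gt0 (I : finType) (del : R) (c a : I) : 0 < del < 1 ->
  0 < noisy del c a.
Proof.
move=> /andP[d0 d1]; rewrite ltr_wpDl//.
  by rewrite mulr_ge0 ?ler0n// subr_ge0 ltW.
by rewrite divr_gt0// ltr0n; apply/card_gt0P; exists c.
Qed.

Lemma noisy_sum (I : finType) (del : R) (c : I) : \sum_a noisy del c a = 1.
Proof.
have I0 : #|I|%:R != 0 :> R.
  by rewrite pnatr_eq0 -lt0n; apply/card_gt0P; exists c.
rewrite big_split/= sumr_const -[X in _ + X]mulr_natl mulrCA divff// mulr1.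
rewrite -mulr_sumr (bigD1 c)//= eqxx big1 => [|a /negPf->//].
by rewrite addr0 mulr1 subrK.
Qed.

Lemma ln_noisy (I : finType) (del : R) (c a : I) : 0 < del < 1 ->
  - ln (noisy del c a) <=
  - ln (1 - del) - ln (del / #|I|%:R) * (a != c)%:R.
Proof.
move=> /andP[d0 d1].
have I1 : 1 <= #|I|%:R :> R.
  by rewrite ler1n; apply/card_gt0P; exists c.
have dI : 0 < del / #|I|%:R by rewrite divr_gt0// (lt_le_trans _ I1).
rewrite /noisy; have [_|_]/= := eqVneq a c.
  rewrite !mulr1 mulr0 subr0 lerN2 ler_ln ?posrE ?subr_gt0//; last first.
    by rewrite addr_gt0// subr_gt0.
  by rewrite lerDl ltW.
rewrite mulr0 add0r mulr1 lerDr oppr_ge0 ln_le0//; lra.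
Qed.

Section block_code.
Context (A : finType) (b : T -> A) (N : nat) (k L : nat).
Variables (Y : T -> 'I_k.+1) (g : {ffun 'I_L -> A} -> 'I_k.+1) (m n : nat).
Variables (del eps : R).
Hypotheses (mb : finite_rv b) (mY : finite_rv Y) (del01 : 0 < del < 1).
Hypothesis approx :
  fine (mu [set x | Y (iter m f x) != g (name f b L x)]) <= eps.

(* Blocks 0, ..., K of length N.+1 cover the times 0, ..., n + L - 1. *)
Let K := ((n + L) %/ N.+1)%N.

Let window (s : {ffun 'I_K.+1 -> {ffun 'I_N.+1 -> A}}) (i : nat) :
    {ffun 'I_L -> A} :=
  [ffun l : 'I_L => s (inord ((i + l) %/ N.+1)%N) (inord ((i + l) %% N.+1)%N)].

Let blocks (x : T) : {ffun 'I_K.+1 -> {ffun 'I_N.+1 -> A}} :=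
  [ffun j : 'I_K.+1 => name f b N.+1 (iter (N.+1 * j)%N f x)].

Let window_blocks x (i : 'I_n) :
  window (blocks x) i = name f b L (iter i f x).
Proof.
apply/ffunP => l; rewrite !ffunE/= !inordK ?ltn_pmod//; last first.
  by rewrite ltnS /K leq_div2r// leq_add// ltnW.
rewrite -!iterD; congr (b (iter _ f x)).
by rewrite addnC mulnC -divn_eq addnC.
Qed.

Let Z (x : T) := (name f Y n (iter m f x), blocks x).

Let mZ : finite_rv Z.
Proof.
apply: finite_rv_pair.
  exact: (@finite_rv_iter _ (name f Y n) m (@finite_rv_name _ _ n mY)).
by apply: finite_rv_ffun => j;
  exact: (@finite_rv_iter _ (name f b N.+1) (N.+1 * j)%N (@finite_rv_name _ _ N.+1 mb)).
Qed.

Let rho := law mu (name f b N.+1).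

(* The reference law: independent blocks, then independent noisy labels
   around the ones decoded from the blocks. *)
Let q (z : {ffun 'I_n -> 'I_k.+1} * {ffun 'I_K.+1 -> {ffun 'I_N.+1 -> A}}) :=
  (\prod_j rho (z.2 j)) * \prod_(i < n) noisy del (g (window z.2 i)) (z.1 i).

Let rho_ge0 w : 0 <= rho w. Proof. exact: law_ge0. Qed.

Let q_ge0 z : 0 <= q z.
Proof. by rewrite mulr_ge0// prodr_ge0// => i _; rewrite ltW// noisy_gt0. Qed.

Let q_sum : \sum_z q z = 1.
Proof.
rewrite -(pair_bigA _ (fun y s => q (y, s)))/= exchange_big/=.
have sumI s : \sum_y q (y, s) = \prod_j rho (s j).
  rewrite /q/= -mulr_sumr/= [X in _ * X](_ : _ = 1) ?mulr1//.
  rewrite -(bigA_distr_bigA (fun (i : 'I_n) a => noisy del (g (window s i)) a))/=.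
  by rewrite big1// => i _; exact: noisy_sum.
under eq_bigr do rewrite sumI.
rewrite -(bigA_distr_bigA (fun _ w => rho w))/= big1// => _ _.
by rewrite law_sum1//; exact: finite_rv_name.
Qed.

Let rho_gt0 z j : 0 < law mu Z z -> 0 < rho (z.2 j).
Proof.
move=> z0; apply: (lt_le_trans z0).
rewrite /rho -(@law_iter _ _ (N.+1 * j)%N _ (@finite_rv_name _ _ N.+1 mb)).
rewrite [X in _ <= law _ X _](_ : _ = (fun z0 : {ffun 'I_n -> 'I_k.+1} * {ffun 'I_K.+1 -> {ffun 'I_N.+1 -> A}} => z0.2 j) \o Z); first exact: law_comp_ge.
by apply/funext => x /=; rewrite ffunE.
Qed.

Let ln_q z : - (law mu Z z * ln (q z)) <=
  \sum_j - (law mu Z z * ln (rho (z.2 j))) +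
  \sum_(i < n) law mu Z z * (- ln (1 - del)
     - ln (del / k.+1%:R) * (z.1 i != g (window z.2 i))%:R).
Proof.
have [p0|p0] := ltrP 0 (law mu Z z); last first.
  have -> : law mu Z z = 0 by apply/eqP; rewrite eq_le p0 law_ge0.
  by rewrite mul0r oppr0 !big1 ?addr0// => i _; rewrite mul0r ?oppr0.
rewrite /q lnM ?posrE; last 2 first.
- by rewrite prodr_gt0// => j _; exact: rho_gt0.
- by rewrite prodr_gt0// => i _; exact: noisy_gt0.
rewrite (ln_prod (fun j => rho_gt0 j p0)).
rewrite (ln_prod (fun i : 'I_n => noisy_gt0 (g (window z.2 i)) (z.1 i) del01)).
rewrite mulrDr opprD !mulr_sumr -!sumrN lerD2l; apply: ler_sum => i _.
rewrite -mulrN ler_wpM2l ?law_ge0//.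
by rewrite (le_trans (ln_noisy _ _ del01))// card_ord.
Qed.

(** The Gibbs inequality for the pair of a [Y]-name, read from time [m] on, and
    the blocks of symbols from which it is decoded. The blocks contribute
    [K.+1] times the entropy of one block, by stationarity, and each of the
    [n] labels contributes the cost of the noise plus, with probability at most
    [eps], the cost of an error. *)
Lemma entropy_name_le : entropy_of (name f Y n) <=
  K.+1%:R * entropy_of (name f b N.+1)
  + n%:R * (- ln (1 - del) - ln (del / k.+1%:R) * eps).
Proof.
have -> : entropy_of (name f Y n) = entropy_of (fst \o Z).
  congr (- _); apply: eq_bigr => w _; rewrite -!/(law mu _ w).
  by rewrite -(law_iter m _ (@finite_rv_name _ _ n mY)).
apply: (le_trans (@entropy_comp_le _ _ _ mu _ _ fst Z mZ)).
have : entropy_of Z <= - \sum_z law mu Z z * ln (q z).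
  apply: gibbs => //; first by rewrite q_sum.
  move=> z z0; rewrite mulr_gt0// prodr_gt0// => i _; first exact: rho_gt0.
  exact: noisy_gt0.
move=> /le_trans; apply; rewrite -sumrN; apply: le_trans (ler_sum _ (fun z _ => ln_q z)) _.
rewrite big_split/= exchange_big/= [X in _ + X]exchange_big/=; apply: lerD.
  rewrite -[X in X%:R]card_ord mulr_natl -sumr_const; apply: ler_sum => j _.
  rewrite sumrN lerN2.
  have := @law_sum_comp _ _ _ mu _ _ (fun z : {ffun 'I_n -> 'I_k.+1} * {ffun 'I_K.+1 -> {ffun 'I_N.+1 -> A}} => z.2 j) Z (fun w => ln (rho w)) mZ.
  move=> <-; rewrite le_eqVlt; apply/orP; left; apply/eqP/eq_bigr => w _.
  rewrite -/(law mu _ w) -/(rho w); congr (_ * _).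
  rewrite -[LHS](@law_iter _ _ (N.+1 * j)%N _ (@finite_rv_name _ _ N.+1 mb)).
  by congr (law mu _ w); apply/funext => x /=; rewrite ffunE.
rewrite -[X in _ <= X%:R * _]card_ord [leRHS]mulr_natl -sumr_const.
apply: ler_sum => i _.
under eq_bigr do rewrite mulrDr (mulrN _ (ln _ * _)) (mulrCA _ (ln (del / _))).
rewrite big_split/= -mulr_suml law_sum1// mul1r lerD2l sumrN lerN2.
have dk : ln (del / k.+1%:R) <= 0.
  apply: ln_le0; case/andP: del01 => d0 d1; rewrite ler_pdivrMr ?ltr0Sn// mul1r.
  by rewrite (le_trans (ltW d1))// ler1n.
rewrite -mulr_sumr; apply: (ler_wnM2l dk).
pose miss (z : {ffun 'I_n -> 'I_k.+1} * {ffun 'I_K.+1 -> {ffun 'I_N.+1 -> A}}) :=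
  z.1 i != g (window z.2 i).
have -> : \sum_z law mu Z z * (miss z)%:R = \sum_(z | miss z) law mu Z z.
  rewrite [RHS]big_mkcond; apply: eq_bigr => z _.
  by case: (miss z); rewrite ?mulr1 ?mulr0.
rewrite -prob_finite_rv//; apply: le_trans approx.
set E := (X in _ <= fine (mu X)).
have mE : measurable E.
  have mYb : finite_rv (fun x => (Y (iter m f x), name f b L x)).
    by apply: finite_rv_pair;
      [exact: (@finite_rv_iter _ Y m mY)|exact: finite_rv_name].
  exact: (finite_rv_preimage [set y | y.1 != g y.2] mYb).
rewrite -(invariant_iter i mE) (_ : Z @^-1` _ = iter i f @^-1` E)//.
apply/seteqP; split=> x; rewrite /E /miss /preimage/= window_blocks ffunE.
  by rewrite -!iterD addnC.
by rewrite -!iterD addnC.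
Qed.
End block_code.

Lemma entropy_ge0 (I : finType) (X : T -> I) : finite_rv X -> 0 <= entropy_of X.
Proof.
move=> mX; rewrite /shannon_entropy -sumrN sumr_ge0// => i _.
rewrite oppr_ge0 mulr_ge0_le0 ?law_ge0// ln_le0// -/(law mu X i).
by rewrite -(law_sum1 mu mX) (bigD1 i)//= lerDl sumr_ge0// => j _; exact: law_ge0.
Qed.

Section generator.
Variables (b : T -> bool) (mb : finite_rv b).

(** The set is read at time [n] from the symbols at times [0, ..., 2n - 1]. The
    delay makes symbols before and after time [n] available although [f] is not
    assumed invertible; it costs nothing as the measure is invariant. *)
Definition code_error (A : set T) (n : nat)
    (g : {ffun 'I_(n + n) -> bool} -> bool) : set T :=
  [set x | (iter n f x \in A) != g (name f b (n + n) x)].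

Definition codable (A : set T) : Prop :=
  forall e : R, 0 < e -> exists n g, (mu (@code_error A n g) < e%:E)%E.

Lemma finite_rv_mem (A : set T) : measurable A -> finite_rv (fun x => x \in A).
Proof.
move=> mA [].
  rewrite [X in measurable X](_ : _ = A)//.
  by apply/seteqP; split=> x; [exact: set_mem|exact: mem_set].
rewrite [X in measurable X](_ : _ = ~` A); first exact: measurableC.
apply/seteqP; split=> x /=; first by move=> /negbT; rewrite notin_setE.
by move=> nAx; apply/negbTE; rewrite notin_setE.
Qed.

Lemma measurable_code_error A n g : measurable A -> measurable (@code_error A n g).
Proof.
move=> mA; pose X x := (iter n f x \in A, name f b (n + n) x).
have mX : finite_rv X.
  apply: finite_rv_pair; last exact: finite_rv_name.
  exact: (@finite_rv_iter _ (fun x => x \in A) n (finite_rv_mem mA)).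
exact: (finite_rv_preimage [set y | y.1 != g y.2] mX).
Qed.

(** By invariance the delay can be increased, so that finitely many codes can
    be given a common window. *)
Lemma code_error_widen A n n' g : (n <= n')%N -> measurable A ->
  exists g', mu (@code_error A n' g') = mu (@code_error A n g).
Proof.
move=> nn' mA.
(* The old window is the middle of the new one; the default value false is
   never read. *)
exists (fun w => g [ffun l : 'I_(n + n) =>
  oapp w false (insub (n' - n + l)%N : option 'I_(n' + n'))]).
rewrite -(invariant_iter (n' - n) (measurable_code_error g mA)); congr (mu _).
have winE x : [ffun l : 'I_(n + n) => oapp (name f b (n' + n') x) false
    (insub (n' - n + l)%N : option 'I_(n' + n'))] =
    name f b (n + n) (iter (n' - n) f x).
  apply/ffunP => l; rewrite !ffunE/= insubT/=.
    by have := ltn_ord l; lia.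
  by move=> h; rewrite ffunE/= -iterD [(l + _)%N]addnC.
by apply/seteqP; split=> x; rewrite /code_error /preimage/= -iterD subnKC// winE.
Qed.

Lemma codableC A : measurable A -> codable A -> codable (~` A).
Proof.
move=> mA cA e /cA[n [g ge]]; exists n, (fun w => ~~ g w).
rewrite [X in mu X](_ : _ = @code_error A n g)//.
by apply/seteqP; split=> x; rewrite /code_error/= in_setC; case: (_ \in _); case: (g _).
Qed.

Lemma codableU A B : measurable A -> measurable B ->
  codable A -> codable B -> codable (A `|` B).
Proof.
move=> mA mB cA cB e e0.
have [n1 [g1 ge1]] := cA _ (divr_gt0 e0 (ltr0n _ 2)).
have [n2 [g2 ge2]] := cB _ (divr_gt0 e0 (ltr0n _ 2)).
have [h1 hE1] := code_error_widen g1 (leq_maxl n1 n2) mA.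
have [h2 hE2] := code_error_widen g2 (leq_maxr n1 n2) mB.
exists (maxn n1 n2), (fun w => h1 w || h2 w).
apply: (@le_lt_trans _ _ (mu (code_error A h1) + mu (code_error B h2))%E).
  apply: (le_trans _ (measureU2 _ _ _)); [|exact: measurable_code_error..].
  apply: le_measure; rewrite ?inE.
  - by apply: measurable_code_error; exact: measurableU.
  - by apply: measurableU; exact: measurable_code_error.
  move=> x; rewrite /code_error/setU/= in_setU.
  case: (_ \in A); case: (_ \in B); case: (h1 _); case: (h2 _) => //= _; by [left|right].
by rewrite hE1 hE2 (splitr e) EFinD lteD.
Qed.

(** Continuity from above of [mu] makes a finite partial union a good
    approximation of the whole union; the error of a code for it splits in two
    parts of measure less than [e / 2]. Together with [codableC] this shows
    that the codable measurable sets form a sigma-algebra. *)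
Lemma codable_bigcup (A : (set T)^nat) : (forall i, measurable (A i)) ->
  (forall i, codable (A i)) -> codable (\bigcup_i A i).
Proof.
move=> mA cA e e0.
pose B n := \big[setU/set0]_(i < n) A i.
have mB n : measurable (B n) by exact: bigsetU_measurable.
have cB n : codable (B n).
  elim: n => [|n IH].
    rewrite /B big_ord0 => e' e'0; exists 0%N, (fun=> false).
    rewrite [X in mu X](_ : _ = set0) ?measure0//.
    by apply/seteqP; split=> x //; rewrite /code_error/= in_set0.
  by rewrite /B big_ord_recr; exact: (codableU (mB n) (mA n) IH (cA n)).
have mU : measurable (\bigcup_i A i) by exact: bigcup_measurable.
have BU : \bigcup_n B n = \bigcup_i A i.
  apply/seteqP; split=> x [n _].
    by rewrite /B -bigcup_mkord => -[i _ Aix]; exists i.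
  by move=> Anx; exists n.+1 => //; rewrite /B -bigcup_mkord; exists n => /=.
have cvgD : mu ((\bigcup_i A i) `\` B n) @[n --> \oo] --> 0%E.
  rewrite -(measure0 mu).
  have -> : set0 = \bigcap_n ((\bigcup_i A i) `\` B n).
    apply/seteqP; split=> // x /= h.
    have [Ux _] := h 0%N I.
    by move: (Ux); rewrite -BU => -[n _ Bnx]; have [_] := h n I; apply.
  apply: nonincreasing_cvg_mu.
  - by rewrite (le_lt_trans (probability_le1 _ _))// ?ltry//; exact: measurableD.
  - by move=> n; exact: measurableD.
  - by apply: bigcap_measurable => // n _; exact: measurableD.
  - move=> n n' nn'; apply/subsetPset; apply: setDS.
    by apply: subset_bigsetU.
have : \forall n \near \oo, (mu ((\bigcup_i A i) `\` B n) < (e / 2)%:E)%E.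
  have [_ /cvgr_lt /(_ (e / 2))] := (fine_cvgP _ _).1 cvgD.
  move=> /(_ (divr_gt0 e0 (ltr0n _ 2))); apply: filterS => k /= ek.
  by rewrite -[X in (X < _)%E]fineK ?lte_fin// fin_num_measure//; exact: measurableD.
move=> [n _ /(_ n (leqnn n))/= hn].
have [n1 [g ge]] := cB n _ (divr_gt0 e0 (ltr0n _ 2)).
exists n1, g.
apply: (@le_lt_trans _ _ (mu (iter n1 f @^-1` ((\bigcup_i A i) `\` B n))
          + mu (code_error (B n) g))%E).
  have mUB : measurable (iter n1 f @^-1` ((\bigcup_i A i) `\` B n)).
    rewrite -[X in measurable X]setTI.
    exact: (measurable_iter n1 measurableT (measurableD mU (mB n))).
  have mE := measurable_code_error g (mB n).
  apply: (le_trans _ (measureU2 _ mUB mE)).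
  apply: le_measure; rewrite ?inE.
  - exact: measurable_code_error.
  - exact: measurableU.
  move=> x; rewrite /code_error/preimage/=.
  case: (boolP (iter n1 f x \in B n)) => [Bx|/negP nBx].
    have -> : iter n1 f x \in \bigcup_i A i.
      by apply/mem_set; rewrite -BU; exists n; [by []|exact: set_mem].
    by right.
  case: (boolP (iter n1 f x \in \bigcup_i A i)) => [Ux _|_]; last by right.
  by left; split; [exact: set_mem|move=> /mem_set].
rewrite invariant_iter; last exact: measurableD.
by rewrite (splitr e) EFinD lteD.
Qed.

(** Codes for the level sets of [Y] combine into a code for [Y]: the decoded
    label is one whose code says yes, and it is right as soon as the codes of
    all the level sets are. *)
Lemma code_labels (k : nat) (Y : T -> 'I_k.+1) (e : R) :
  (forall A, measurable A -> codable A) -> finite_rv Y -> 0 < e ->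
  exists n (g : {ffun 'I_(n + n) -> bool} -> 'I_k.+1),
    fine (mu [set x | Y (iter n f x) != g (name f b (n + n) x)]) <= e.
Proof.
move=> gen mY e0; pose A (i : 'I_k.+1) := Y @^-1` [set i].
have e'0 : 0 < e / k.+1%:R by rewrite divr_gt0.
have [N [g0 gN]] : exists N : 'I_k.+1 -> nat,
    exists g : forall i, {ffun 'I_(N i + N i) -> bool} -> bool,
    forall i, (mu (code_error (A i) (g i)) < (e / k.+1%:R)%:E)%E.
  have /choice[N hN] : forall i, exists n, exists g,
      (mu (@code_error (A i) n g) < (e / k.+1%:R)%:E)%E.
    by move=> i; exact: (gen _ (mY i)).
  by exists N; exists (fun i => sval (cid (hN i))) => i; exact: (svalP (cid (hN i))).
pose n := \max_i N i.
have /choice[g gn] : forall i, exists g,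
    (mu (@code_error (A i) n g) < (e / k.+1%:R)%:E)%E.
  move=> i; have Nn : (N i <= n)%N by exact: leq_bigmax.
  have [g hg] := code_error_widen (g0 i) Nn (mY i).
  by exists g; rewrite hg; exact: gN.
exists n, (fun w => odflt ord0 [pick i | g i w]).
set E := (X in mu X).
have mX : finite_rv (fun x => (Y (iter n f x), name f b (n + n) x)).
  apply: finite_rv_pair; last exact: finite_rv_name.
  exact: (@finite_rv_iter _ Y n mY).
have mE : measurable E.
  exact: (finite_rv_preimage [set y | y.1 != odflt ord0 [pick i | g i y.2]] mX).
rewrite -lee_fin fineK ?fin_num_measure//.
pose F j := code_error (A (inord j)) (g (inord j)).
have mF j : measurable (F j) by apply: measurable_code_error; exact: mY.
apply: (@le_trans _ _ (mu (\big[setU/set0]_(j < k.+1) F j))).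
  apply: le_measure; rewrite ?inE//; first exact: bigsetU_measurable.
  move=> x; apply: contraPP => nF.
  have Fx (i : 'I_k.+1) : (iter n f x \in A i) = g i (name f b (n + n) x).
    apply/eqP/negP => /negP ne; apply: nF.
    by rewrite -bigcup_mkord; exists i => //=; rewrite /F inord_val.
  have AY i : (iter n f x \in A i) = (Y (iter n f x) == i).
    apply/idP/eqP => [h|h]; [exact: (set_mem h)|exact: mem_set].
  rewrite /E/=; apply/negP; rewrite negbK; apply/eqP.
  case: pickP => [i|/(_ (Y (iter n f x)))]; rewrite -Fx AY ?eqxx//.
  by move=> /eqP.
apply: (le_trans (Boole_inequality _ _)) => //.
apply: (@le_trans _ _ (\sum_(j < k.+1) (e / k.+1%:R)%:E)%E).
  by apply: lee_sum => j _; rewrite ltW//; exact: gn.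
by rewrite sumEFin sumr_const card_ord -[X in (X%:E <= _)%E]mulr_natr divfK.
Qed.

Hypothesis gen : forall A, measurable A -> codable A.

(** The excess [eta] is shared equally between the noise ([del]), the decoding
    errors, and the boundary terms [C], which do not grow with the length [n]
    of the name. *)
Lemma entropy_name_rate (k N : nat) (Y : T -> 'I_k.+1) (eta : R) :
  finite_rv Y -> 0 < eta ->
  \forall n \near \oo, entropy_of (name f Y n) / n%:R <=
     entropy_of (name f b N.+1) / N.+1%:R + eta.
Proof.
move=> mY eta0.
pose del := 1 - expR (- (eta / 3)).
have del01 : 0 < del < 1.
  rewrite /del subr_gt0 gtrBl expR_gt0 andbT.
  by rewrite -[ltRHS](expR0) ltr_expR oppr_lt0 divr_gt0.
have lndel : - ln (1 - del) = eta / 3 by rewrite /del subKr expRK opprK.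
pose c := - ln (del / k.+1%:R).
have c0 : 0 <= c.
  rewrite oppr_ge0 ln_le0// ler_pdivrMr ?ltr0Sn// mul1r.
  by case/andP: del01 => _ /ltW/le_trans; apply; rewrite ler1n.
have eps0 : 0 < eta / 3 / (c + 1) by rewrite !divr_gt0// ltr_wpDl.
have [m [g approx]] := code_labels gen mY eps0.
set h := entropy_of (name f b N.+1) / N.+1%:R.
have H0 : 0 <= entropy_of (name f b N.+1) by apply: entropy_ge0; exact: finite_rv_name.
have h0 : 0 <= h by rewrite divr_ge0.
pose C := (m + m)%:R * h + entropy_of (name f b N.+1).
exists (Num.bound (C / (eta / 3))).+1 => // n /= nC.
have n0 : 0 < n%:R :> R by rewrite ltr0n (leq_trans _ nC).
have Cn : C <= n%:R * (eta / 3).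
  rewrite -ler_pdivrMr ?divr_gt0//; apply: ltW; apply: (lt_trans (archi_boundP _)).
    by rewrite divr_ge0 ?divr_ge0 ?addr_ge0 ?mulr_ge0// ltW.
  by rewrite ltr_nat.
rewrite ler_pdivrMr//.
apply: (le_trans (entropy_name_le N n mb mY del01 approx)).
rewrite lndel -/c.
have lneps : - ln (del / k.+1%:R) * (eta / 3 / (c + 1)) <= eta / 3.
  rewrite -/c mulrCA ger_pMr ?divr_gt0// ler_pdivrMr ?ltr_wpDl//; lra.
have KN : ((n + (m + m)) %/ N.+1)%N%:R * entropy_of (name f b N.+1) <=
    (n%:R + (m + m)%:R) * h.
  rewrite /h mulrA ler_pdivlMr ?ltr0Sn// mulrAC ler_wpM2r//.
  by rewrite -natrM -natrD ler_nat leq_divM.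
have nlneps : n%:R * (- ln (del / k.+1%:R) * (eta / 3 / (c + 1))) <=
    n%:R * (eta / 3) by rewrite ler_wpM2l// ltW.
rewrite -/h -natr1 mulrDl mul1r.
move: KN Cn nlneps; rewrite /C.
set KH := _%:R * _; set H := entropy_of _; set M := (m + m)%:R.
move: (n%:R) (ln _) (_ / (c + 1)) => n' u v; lra.
Qed.

(** Every finite partition is a function of finitely many symbols [b] up to a
    small error, so its names are not essentially more numerous than the blocks
    of symbols behind them. *)
Lemma entropy_le_block N :
  (entropy mu f <= (entropy_of (name f b N.+1) / N.+1%:R)%:E)%E.
Proof.
apply: ge_ereal_sup => _ [k [P [[mP tP cP] ->]]]; rewrite lee_fin.
case: k P mP tP cP => [|k] P mP tP cP.
  by have : [set: T] point by []; rewrite -cP => -[[]].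
have /choice[Y PY] : forall x, exists i, P i x.
  by move=> x; have : [set: T] x by []; rewrite -cP => -[i _ Pix]; exists i.
have YP i : Y @^-1` [set i] = P i.
  apply/seteqP; split=> [x <-//|x Pix]; rewrite /preimage/=.
  by apply: tP => //; exists x; split.
have mY : finite_rv Y by move=> i; rewrite YP.
have -> : entropy_wrt mu f P = limn (fun n => entropy_of (name f Y n) / n%:R).
  congr (limn _); apply/funext => n; congr (_ / _).
  congr (- _); apply: eq_bigr => w _.
  suff -> : join_atom f P w = name f Y n @^-1` [set w] by [].
  rewrite /join_atom; apply/seteqP; split=> x /= h.
    apply/ffunP => i; rewrite ffunE.
    by have := h i I; rewrite /preimage/= -YP.
  by move=> i _; rewrite /preimage/= -YP -h ffunE.
(* Without convergence, limn would take the default value 0, which the bound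
   exceeds as well. *)
have [cvgY|/dvgP ->] := pselect (cvgn (fun n => entropy_of (name f Y n) / n%:R)).
  apply/ler_addgt0Pr => eta eta0; apply: limr_le => //.
  exact: entropy_name_rate.
by rewrite divr_ge0// entropy_ge0//; exact: finite_rv_name.
Qed.

End generator.
End entropy_of_names.

(** * Spaces coded by binary symbols *)

(** Neighbourhoods for pointwise convergence constrain finitely many
    coordinates: the sets with this property form a filter converging to
    [x]. *)
Lemma nbhs_ptws (V : uniformType) (x : nat -> V) (O : set {ptws nat -> V}) :
  nbhs (x : {ptws nat -> V}) O ->
  exists n (A : nat -> set V), (forall i, nbhs (x i) (A i)) /\
    forall y, (forall i, (i < n)%N -> A i (y i)) -> O y.
Proof.
pose F : set_system (nat -> V) := [set B | exists n (A : nat -> set V),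
  (forall i, nbhs (x i) (A i)) /\
  forall y, (forall i, (i < n)%N -> A i (y i)) -> B y].
have FF : Filter F.
  split.
  - by exists 0%N, (fun=> setT); split => // i; exact: filterT.
  - move=> B1 B2 [n1 [A1 [nA1 AB1]]] [n2 [A2 [nA2 AB2]]].
    exists (maxn n1 n2), (fun i => A1 i `&` A2 i); split.
      by move=> i; exact: filterI.
    move=> y Ay; split.
      by apply: AB1 => i ii; case: (Ay i); rewrite // leq_max ii.
    by apply: AB2 => i ii; case: (Ay i); rewrite // leq_max ii orbT.
  - move=> B1 B2 B12 [n [A [nA AB]]]; exists n, A; split => // y Ay.
    exact/B12/AB.
suff : {ptws, F --> x} by move=> /(_ O); exact.
apply/pointwise_cvgP => t B nB.
exists t.+1, (fun i => if i == t then B else setT); split.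
  by move=> i; case: eqP => [->//|_]; exact: filterT.
by move=> y /(_ t (ltnSn t)); rewrite eqxx.
Qed.

Lemma ptws_eval_continuous (V : uniformType) (k : nat) :
  continuous (fun x : {ptws nat -> V} => x k).
Proof.
move=> x; have /pointwise_cvgP : {ptws, nbhs (x : {ptws nat -> V}) --> (x : nat -> V)}.
  exact: cvg_id.
exact.
Qed.

Lemma pushforward_probability (d d' : measure_display) (X : measurableType d)
    (Y : measurableType d') (R : realType) (P : probability X R) (phi : X -> Y) :
  measurable_fun setT phi ->
  exists Q : probability Y R, forall A, Q A = P (phi @^-1` A).
Proof.
move=> mphi.
pose phi' : {mfun X >-> Y} :=
  HB.pack phi (isMeasurableFun.Build _ _ _ _ phi mphi).
by exists (distribution P phi').
Qed.

Section coding.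
Context (D : countType) (T : ptopologicalType) (c : D -> T -> bool).

Definition cyl (l : seq (D * bool)) : set T :=
  [set x | all (fun p => c p.1 x == p.2) l].

Definition locally_coded (O : set T) : Prop := forall x, O x ->
  exists E : seq D, forall y, (forall d, d \in E -> c d y = c d x) -> O y.

(** The symbols are continuous, and finitely many of them at a point always
    determine a neighbourhood inside a given open set. In other words the
    cylinders form a base of the topology. *)
Definition coding : Prop :=
  (forall d v, open (c d @^-1` [set v])) /\ (forall O, open O -> locally_coded O).

Hypothesis codc : coding.

Lemma cyl_cons d v l : cyl ((d, v) :: l) = (c d @^-1` [set v]) `&` cyl l.
Proof.
apply/seteqP; split=> x; rewrite /cyl/=; first by move=> /andP[/eqP].
by move=> [-> ->]; rewrite eqxx.
Qed.

Lemma measurable_cyl l : measurable (cyl l : set (borel T)).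
Proof.
elim: l => [|[d v] l IH].
  by rewrite (_ : cyl [::] = setT)//; exact/seteqP.
rewrite cyl_cons; apply: measurableI => //.
by apply: sub_sigma_algebra; exact: codc.1.
Qed.

(* Finite lists over a countable type are countable, so an open set is the
   countable union of the cylinders that it contains. *)
Definition subcyl (O : set T) (u : option (seq (D * bool))) : set T :=
  if u is Some l then [set x | cyl l x /\ cyl l `<=` O] else set0.

Lemma locally_coded_cyl (O : set T) : locally_coded O ->
  O = \bigcup_n subcyl O (unpickle n).
Proof.
move=> oO; apply/seteqP; split=> [x Ox|x [n _]]; last first.
  by case: (unpickle n) => // l [lx]; exact.
have [E hE] := oO x Ox.
exists (pickle [seq (d, c d x) | d <- E]) => //; rewrite pickleK /subcyl; split.
  by rewrite /cyl/= all_map; apply/allP => d _ /=.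
move=> y /allP hy; apply: hE => d dE.
by have /eqP := hy (d, c d x) (map_f (fun d => (d, c d x)) dE).
Qed.

Lemma locally_coded_borel (O : set T) : locally_coded O -> <<s range cyl >> O.
Proof.
move=> oO; rewrite (locally_coded_cyl oO); apply: sigma_algebra_bigcup => n.
case: (unpickle n) => [l|]; last exact: sigma_algebra0.
have [lO|lO] := pselect (cyl l `<=` O); last first.
  by rewrite [X in _ X](_ : _ = set0); [exact: sigma_algebra0|apply/seteqP; split=> x // []].
apply: sub_sigma_algebra; exists l => //.
by apply/seteqP; split=> x // [].
Qed.

Lemma borel_cyl : @open T `<=` <<s range cyl >>.
Proof. by move=> O oO; apply: locally_coded_borel; exact: codc.2. Qed.

Lemma borel_cylE : @measurable _ (borel T) = <<s range cyl >>.
Proof.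
apply/seteqP; split.
  by apply: smallest_sub; [exact: smallest_sigma_algebra|exact: borel_cyl].
apply: smallest_sub; first exact: sigma_algebra_measurable.
by move=> _ [l _ <-]; exact: measurable_cyl.
Qed.

Lemma measurable_fun_coding (d : measure_display) (X : measurableType d)
    (phi : X -> borel T) :
  (forall d v, measurable [set x | c d (phi x) = v]) -> measurable_fun setT phi.
Proof.
move=> mc; apply: (measurability _ borel_cylE) => _ [_ [l _ <-] <-].
rewrite setTI; elim: l => [|[e v] l IH].
  by rewrite (_ : _ @^-1` _ = setT)//; exact/seteqP.
by rewrite cyl_cons preimage_setI; apply: measurableI => //; exact: mc.
Qed.

Lemma coding_measure_unique (R : realType) (m1 m2 : probability (borel T) R) :
  (forall l, m1 (cyl l) = m2 (cyl l)) ->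
  forall A, measurable A -> m1 A = m2 A.
Proof.
move=> m12 A mA.
have rm : (range cyl : set (set (borel T))) `<=` measurable.
  by move=> _ [l _ <-]; exact: measurable_cyl.
have rT : forall i : nat, (range cyl : set (set (borel T))) setT.
  by move=> _; exists [::] => //; exact/seteqP.
have rI : setI_closed (range cyl : set (set (borel T))).
  move=> _ _ [l1 _ <-] [l2 _ <-]; exists (l1 ++ l2) => //.
  apply/seteqP; split=> x; rewrite /cyl/= all_cat; first by move=> /andP[].
  by move=> [-> ->].
have bT : \bigcup_(k : nat) [set: borel T] = setT by rewrite bigcup_const.
apply: (@g_sigma_algebra_measure_unique _ _ _ _ rm _ rT bT m1 m2 rI).
- by move=> _ [l _ <-]; exact: m12.
- by move=> _; rewrite (le_lt_trans (probability_le1 _ _))// ltry.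
- by rewrite -borel_cylE.
Qed.

End coding.

(** * The fair coin measure *)

Section fair.
Context (D : countType) (T : ptopologicalType) (c : D -> T -> bool).
Hypothesis codc : coding c.
Context (R : realType).

Definition fair (m : probability (borel T) R) : Prop :=
  forall l, uniq (unzip1 l) -> m (cyl c l) = (2^-1 ^+ size l)%:E.

(** In an arbitrary list a symbol may be prescribed twice, consistently or
    not. *)
Definition cyl_mass (l : seq (D * bool)) : R :=
  if uniq (unzip1 (undup l)) then 2^-1 ^+ size (undup l) else 0.

Lemma fair_cyl m : fair m -> forall l, m (cyl c l) = (cyl_mass l)%:E.
Proof.
move=> fm l; rewrite /cyl_mass.
have -> : cyl c l = cyl c (undup l).
  by apply/seteqP; split=> x /allP h; apply/allP => p;
    [rewrite mem_undup|rewrite -mem_undup]; exact: h.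
case: ifPn => [/fm//|nu].
rewrite [X in m X](_ : _ = set0) ?measure0//; apply/seteqP; split=> // x /allP h.
case/negP: nu; rewrite map_inj_in_uniq ?undup_uniq// => -[d v] [d' v'] /h/=.
by move=> /eqP <- /h/= /eqP <- ->.
Qed.

End fair.

Section fair_coin.
Variable R : realType.

Definition symbol (k : nat) (s : cantor_space) : bool := s k.

Lemma coding_symbol : coding symbol.
Proof.
split=> [k v|O oO s Os].
  have := (continuousP _).1 (@ptws_eval_continuous bool k).
  by apply; exact: discrete_open.
have [n [A [nA AO]]] := @nbhs_ptws bool s O (open_nbhs_nbhs (conj oO Os)).
exists (iota 0 n) => t ts; apply: AO => i ii.
have := ts i; rewrite mem_iota/= add0n /symbol => ->//.
exact: nbhs_singleton.
Qed.

Definition doubling (x : R) : R := if x < 2^-1 then 2 * x else 2 * x - 1.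

Definition binary_digits (x : R) : cantor_space :=
  fun k => 2^-1 <= iter k doubling x.

Fixpoint dyadic (n : nat) (w : nat -> bool) : R :=
  if n is n'.+1 then ((w 0%N)%:R + dyadic n' (fun i => w i.+1)) / 2 else 0.

Lemma dyadic_itv n w : 0 <= dyadic n w /\ dyadic n w + 2^-1 ^+ n <= 1.
Proof.
elim: n w => [|n IH] w /=; first by rewrite expr0; lra.
have [] := IH (fun i => w i.+1); rewrite exprS.
by case: (w 0%N) => /=; lra.
Qed.

(** [doubling] maps each half of [0, 1) affinely onto [0, 1), so prescribing
    one more digit halves the interval. *)
Lemma binary_digits_prefix n w :
  [set x : R | 0 <= x < 1 /\ forall i, (i < n)%N -> binary_digits x i = w i] =
  `[dyadic n w, dyadic n w + 2^-1 ^+ n[%classic.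
Proof.
elim: n w => [|n IH] w.
  by apply/seteqP; split=> x /=; rewrite in_itv/= expr0 add0r => // -[].
have [a0 a1] := dyadic_itv n (fun i => w i.+1).
have IHx x : [set x : R | 0 <= x < 1 /\ forall i, (i < n)%N ->
     binary_digits x i = w i.+1] x =
  (`[dyadic n (fun i => w i.+1), dyadic n (fun i => w i.+1) + 2^-1 ^+ n[%classic x).
  by rewrite IH.
have step x : (0 <= x < 1 /\ forall i, (i < n.+1)%N -> binary_digits x i = w i) <->
   ((2^-1 <= x) = w 0%N /\
    `[dyadic n (fun i => w i.+1), dyadic n (fun i => w i.+1) + 2^-1 ^+ n[%classic
      (doubling x)).
  rewrite -IHx /=; split.
    move=> [x01 h]; split; first exact: (h 0%N).
    split; last by move=> i ii; rewrite -(h i.+1)// /binary_digits -iterSr.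
    move: x01 => /andP[x0 x1]; rewrite /doubling.
    by apply/andP; case: ltrP; split; lra.
  move=> [h0 [/andP[h1 h2] h]]; split.
    by move: h1 h2; rewrite /doubling => h1 h2; apply/andP; move: h1 h2; case: ltrP; split; lra.
  by move=> [|i] ii//; rewrite -(h i)// /binary_digits -iterSr.
apply/seteqP; split=> x.
  move=> /= /step[h]; rewrite /= !in_itv/= /doubling exprS -h.
  by case: ltrP => x2 /= /andP[h1 h2]; apply/andP; split; lra.
rewrite /= in_itv/= exprS => /andP[h1 h2]; apply/step.
rewrite /= in_itv/= /doubling.
move: h1 h2; case: (w 0%N) => /= h1 h2; case: ltrP => x2 /=; split => //;
  by [lra|apply/andP; split; lra].
Qed.

Lemma uniform_prob_itv (a h : R) : 0 <= a -> 0 < h -> a + h <= 1 ->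
  uniform_prob (@ltr01 R) `[a, a + h[%classic = h%:E.
Proof.
move=> a0 h0 ah; rewrite /uniform_prob (eq_integral (fun=> 1%:E)).
  rewrite integral_cst//= mul1e lebesgue_measure_itv/= lte_fin ltrDl h0.
  by rewrite -EFinD addrAC subrr add0r.
move=> x; rewrite inE/= in_itv/= => /andP[ax xh]; rewrite /uniform_pdf.
by rewrite ifT ?subr0 ?invr1//; apply/andP; split; lra.
Qed.

Lemma measurable_binary_digits :
  measurable_fun setT (binary_digits : R -> borel cantor_space).
Proof.
have md : measurable_fun setT doubling.
  apply: measurable_fun_if => //=.
  - exact: measurable_fun_ltr.
  - apply: measurable_funB; last exact: measurable_cst.
    exact: (@mulrl_measurable R _ 2).
have mi k : measurable_fun setT (iter k doubling).
  elim: k => [|k IH]; first exact: measurable_id.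
  by rewrite (_ : iter k.+1 doubling = doubling \o iter k doubling)//;
    exact: measurableT_comp.
apply: (measurable_fun_coding coding_symbol) => k v.
rewrite -[X in measurable X]setTI.
have mf : measurable_fun setT (fun x => 2^-1 <= iter k doubling x).
  exact: measurable_fun_ler.
exact: (mf measurableT [set v] I).
Qed.

Lemma uniq_keys (l : seq (nat * bool)) p q : uniq (unzip1 l) ->
  p \in l -> q \in l -> p.1 = q.1 -> p = q.
Proof.
elim: l => //= a l IH /andP[al ul]; rewrite !inE.
have no r : r \in l -> r.1 <> a.1.
  by move=> rl ra; case/negP: al; rewrite -ra; exact: map_f.
by move=> /predU1P[->|pl] /predU1P[->|ql]// pq;
  [have := no q ql|have := no p pl|exact: IH]; rewrite pq.
Qed.

(** Cylinders with gaps reduce to prefixes by splitting over the value of a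
    free coordinate, with induction on the number [m] of free coordinates. *)
Lemma fair_of_prefix (P : probability (borel cantor_space) R) :
  (forall n w, P [set s : cantor_space | forall i, (i < n)%N -> s i = w i] =
     (2^-1 ^+ n)%:E) ->
  fair symbol P.
Proof.
move=> Pprefix l.
have [n ln] : exists n, all (fun k => (k < n)%N) (unzip1 l).
  exists (\max_(k <- unzip1 l) k).+1; apply/allP => k kl.
  by rewrite ltnS; exact: leq_bigmax_seq.
have mcyl := @measurable_cyl _ cantor_space _ coding_symbol.
move=> ul; have [m lm] : exists m, (size l + m = n)%N.
  exists (n - size l)%N; rewrite subnKC//.
  rewrite -(size_map fst) -(size_iota 0 n); apply: uniq_leq_size => // k kl.
  by rewrite mem_iota/= add0n; exact: (allP ln).
elim: m l ul ln lm => [|m IH] l ul ln lm.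
  pose w k := (k, true) \in l.
  have lw k v : (k, v) \in l -> w k = v.
    case: v => kv; first exact: kv.
    by apply/negP => kt; have := uniq_keys ul kt kv erefl.
  have wl k : (k < n)%N -> (k, w k) \in l.
    move=> kn; have : k \in unzip1 l.
      have sub : {subset unzip1 l <= iota 0 n}.
        by move=> j /(allP ln); rewrite mem_iota/= add0n.
      have sz : (size (iota 0 n) <= size (unzip1 l))%N.
        by rewrite size_iota size_map -lm addn0.
      by rewrite (uniq_min_size ul sub sz).2 mem_iota/= add0n.
    by move=> /mapP[[k' v] kv /= ->]; rewrite (lw _ _ kv).
  rewrite -[size l]addn0 lm -(Pprefix n w); congr (P _).
  apply/seteqP; split=> s /= h; first by move=> i /wl /(allP h)/eqP.
  apply/allP => -[k v] kv; rewrite /symbol/= h ?(lw _ _ kv)//.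
  by apply: (allP ln); exact: (map_f fst kv).
have [k kn kl] : exists2 k, (k < n)%N & k \notin unzip1 l.
  apply/not_exists2P => h.
  have : (size (iota 0 n) <= size (unzip1 l))%N.
    apply: uniq_leq_size; first exact: iota_uniq.
    move=> k; rewrite mem_iota/= add0n => kn.
    by have [|/negP] := h k; rewrite ?kn// negbK.
  by rewrite size_iota size_map -lm; lia.
have half v : P (cyl symbol ((k, v) :: l)) = (2^-1 ^+ (size l).+1)%:E.
  by rewrite (IH ((k, v) :: l))//= ?kl ?kn ?addSnnS.
have -> : cyl symbol l = cyl symbol ((k, true) :: l) `|` cyl symbol ((k, false) :: l).
  rewrite !cyl_cons -setIUl [X in X `&` _](_ : _ = setT) ?setTI//.
  by apply/seteqP; split=> s // _; rewrite /preimage/=; case: (symbol k s); [left|right].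
rewrite measureU; [|exact: mcyl|exact: mcyl|].
  transitivity ((2^-1 ^+ (size l).+1)%:E + (2^-1 ^+ (size l).+1)%:E : \bar R)%E.
    by congr (_ + _)%E; exact: half.
  by rewrite -EFinD; congr (_%:E); rewrite exprS; lra.
by apply/seteqP; split=> s //; rewrite !cyl_cons => -[[/= -> _] []].
Qed.

(** The binary digits of a uniform random number in [0, 1]. *)
Lemma fair_coin : exists P : probability (borel cantor_space) R, fair symbol P.
Proof.
have [P PE] := pushforward_probability (uniform_prob (@ltr01 R))
  measurable_binary_digits.
exists P; apply: fair_of_prefix => n w.
set E := [set s | _].
have EE : E = cyl symbol [seq (i, w i) | i <- iota 0 n].
  apply/seteqP; split=> s h.
    by apply/allP => _ /mapP[i + ->]; rewrite mem_iota add0n/= => /h e;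
      rewrite /symbol/= e.
  move=> i iN; apply/eqP; apply: (allP h (i, w i)).
  by apply: map_f; rewrite mem_iota add0n.
have mB : measurable (binary_digits @^-1` E : set R).
  rewrite -[X in measurable X]setTI; apply: measurable_binary_digits => //.
  by rewrite EE; exact: (measurable_cyl coding_symbol).
rewrite PE -[LHS]/(uniform_prob (@ltr01 R) _).
(* [binary_digits_prefix] is about [0, 1), whose complement is null. *)
rewrite (@measureDI _ _ _ (uniform_prob (@ltr01 R)) _ `[0, 1[%classic)//.
have u01 : uniform_prob (@ltr01 R) `[0, 1[%classic = 1%:E.
  by have := @uniform_prob_itv 0 1; rewrite add0r; apply; lra.
rewrite [X in (X + _)%E](_ : _ = 0%E) ?add0e; last first.
  apply/eqP; rewrite eq_le measure_ge0 andbT.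
  rewrite -[leRHS](_ : uniform_prob (@ltr01 R) (~` `[0, 1[%classic) = 0%E).
    apply: le_measure; rewrite ?inE; [exact: measurableD|exact: measurableC|].
    by move=> x [].
  rewrite probability_setC//; transitivity (1 - 1%:E : \bar R)%E.
    by congr (_ - _)%E; exact: u01.
  by rewrite subee.
have -> : binary_digits @^-1` E `&` `[0, 1[ =
  [set x : R | 0 <= x < 1 /\ forall i, (i < n)%N -> binary_digits x i = w i].
  by apply/seteqP; split=> x /=; rewrite in_itv/= => -[h1 h2].
rewrite binary_digits_prefix; have [a0 a1] := dyadic_itv n w.
by apply: uniform_prob_itv => //; rewrite exprn_gt0.
Qed.

End fair_coin.

(** * Maximal entropy on coded shifts *)

(** The index set [D] with its translation [S] stands for [nat] or [int] with
    the successor, which gives the one-sided and the two-sided 2-shift.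
    Hypothesis [reach] says that the positive half-line from [d0] is reached
    from every index, so that the symbol at [d0] generates under delayed
    coding. *)

Section coded_shift.
Context (D : countType) (T : ptopologicalType) (c : D -> T -> bool).
Context (f : T -> T) (S : D -> D) (d0 : D) (R : realType).
Hypothesis codc : coding c.
Hypothesis surjc : forall s : D -> bool, exists x, forall d, c d x = s d.
Hypothesis c_shift : forall d x, c d (f x) = c (S d) x.
Hypothesis injS : injective S.
Hypothesis inj0 : injective (fun i => iter i S d0).
Hypothesis reach : forall d, exists m i, iter m S d = iter i S d0.

Let c_iter d n x : c d (iter n f x) = c (iter n S d) x.
Proof. by elim: n d => // n IH d; rewrite iterS c_shift IH -iterSr. Qed.

Lemma measurable_code d : finite_rv (c d : borel T -> bool).
Proof. by move=> v; apply: sub_sigma_algebra; exact: codc.1. Qed.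

Lemma measurable_shift : measurable_fun setT (f : borel T -> borel T).
Proof.
apply: (measurable_fun_coding codc) => d v.
rewrite [X in measurable X](_ : _ = c (S d) @^-1` [set v]).
  exact: measurable_code.
by apply/seteqP; split=> x; rewrite /= c_shift.
Qed.

(** By [surjc] the symbols can be prescribed at will; they are taken to be the
    tosses of a fair coin, through an enumeration of [D]. *)
Lemma fair_system : exists m : probability (borel T) R, fair c m.
Proof.
have [P fP] := fair_coin R.
have /choice[dec decE] := fun s : cantor_space => surjc (fun d => s (pickle d)).
have mdec : measurable_fun setT (dec : borel cantor_space -> borel T).
  apply: (measurable_fun_coding codc) => d v.
  rewrite [X in measurable X](_ : _ = cyl symbol [:: (pickle d, v)]).
    exact: (measurable_cyl coding_symbol).
  by apply/seteqP; split=> s; rewrite /cyl/= decE andbT => /eqP.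
have [m mE] := pushforward_probability P mdec.
exists m => l ul; rewrite mE.
rewrite [X in P X](_ : _ = cyl symbol [seq (pickle p.1, p.2) | p <- l]).
  rewrite fP ?size_map//.
  rewrite /unzip1 -map_comp (map_comp pickle) map_inj_uniq//.
apply/seteqP; split=> s; rewrite /cyl/preimage/= all_map => /allP h;
  by apply/allP => p /h /=; rewrite decE.
Qed.

Lemma fair_invariant (m : probability (borel T) R) : fair c m ->
  invariant_measure m (f : borel T -> borel T).
Proof.
move=> fm A mA.
have [m' m'E] := pushforward_probability m measurable_shift.
rewrite -m'E; apply: (coding_measure_unique codc) => // l.
rewrite m'E.
rewrite [X in m X](_ : _ = cyl c [seq (S p.1, p.2) | p <- l]); last first.
  apply/seteqP; split=> s; rewrite /cyl/preimage/= all_map => /allP h;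
    by apply/allP => p /h /=; rewrite c_shift.
rewrite !(fair_cyl fm) /cyl_mass undup_map_inj; last first.
  by move=> [d v] [d' v'] /= [/injS -> ->].
by rewrite size_map /unzip1 -map_comp (map_comp S) map_inj_uniq.
Qed.

Let b := c d0.

Lemma fair_join_atom (m : probability (borel T) R) k (g : 'I_k -> bool) n
    (w : {ffun 'I_n -> 'I_k}) : fair c m ->
  m (join_atom f (fun i => b @^-1` [set g i]) w) = (2^-1 ^+ n)%:E.
Proof.
move=> fm.
rewrite [X in m X](_ : _ = cyl c [seq (iter i S d0, g (w i)) | i : 'I_n <- enum 'I_n]).
  rewrite fm; first by rewrite size_map size_enum_ord.
  rewrite /unzip1 -map_comp map_inj_uniq ?enum_uniq// => i j /inj0.
  exact: val_inj.
apply/seteqP; split=> x h.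
  apply/allP => _ /mapP[i _ ->] /=; have := h i I.
  by rewrite /preimage/= /b c_iter => ->.
move=> i _; rewrite /preimage/= /b c_iter; apply/eqP.
by apply: (allP h (iter i S d0, g (w i))); apply: map_f; rewrite mem_enum.
Qed.

(** For the partition by the symbol at [d0] all atoms of the [n]-th join have
    mass [2^-1 ^+ n], and the normalised entropies are constantly [ln 2]. *)
Lemma fair_entropy (m : probability (borel T) R) : fair c m ->
  ((ln 2)%:E <= entropy m (f : borel T -> borel T))%E.
Proof.
move=> fm; apply: ereal_sup_ubound.
pose g (i : 'I_2) := i == ord_max.
exists 2%N, (fun i => b @^-1` [set g i]); split.
  split.
  - by move=> i; exact: measurable_code.
  - move=> i j _ _ [x [/= bi bj]]; have {bi bj} : g i = g j by rewrite -bi -bj.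
    by case: i j => [[|[|i]]// ?] [[|[|j]]// ?]// _; exact: val_inj.
  - apply/seteqP; split=> // x _; case bx: (b x).
      by exists ord_max => //=; rewrite /preimage/= bx.
    by exists ord0 => //=; rewrite /preimage/= bx.
congr (_%:E); apply/esym/cvg_lim => //.
apply: cvg_near_cst; exists 1%N => // n /= n1.
rewrite /shannon_entropy.
under eq_bigr do rewrite (fair_join_atom g _ fm)/=.
rewrite sumr_const card_ffun !card_ord exprVn lnV ?posrE ?exprn_gt0// lnXn//.
rewrite -[_ *+ (2 ^ n)%N]mulr_natl -[ln 2 *+ n]mulr_natl natrX.
have a0 : (2 : R) ^+ n != 0 by rewrite expf_neq0.
have b0 : n%:R != 0 :> R by rewrite pnatr_eq0 -lt0n.
by move: (2 ^+ n) (n%:R) (ln 2) a0 b0 => p q r p0 q0; field; rewrite p0 q0.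
Qed.

(** A symbol at index [d] is seen, after a delay, as a later value of the
    symbol at [d0], hence it is coded without error. *)
Lemma codable_cyl (m : probability (borel T) R) l :
  invariant_measure m (f : borel T -> borel T) ->
  codable m (f : borel T -> borel T) (b : borel T -> bool) (cyl c l).
Proof.
move=> invm.
have mb : finite_rv (b : borel T -> bool) by exact: measurable_code.
elim: l => [|[d v] l IH].
  move=> e e0; exists 0%N, (fun=> true).
  rewrite [X in m X](_ : _ = set0) ?measure0//.
  apply/seteqP; split=> x //; rewrite /code_error/=.
  by rewrite (_ : cyl c [::] = setT) ?in_setT//; exact/seteqP.
have -> : cyl c ((d, v) :: l) = ~` (~` (c d @^-1` [set v]) `|` ~` cyl c l).
  by rewrite setCU !setCK cyl_cons.
have ml := measurable_cyl codc l.
have md := measurable_code d v.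
apply: codableC; first by apply: measurableU; exact: measurableC.
apply: codableU => //; [exact: measurable_shift|exact: measurableC..| |].
  apply: codableC => // e e0; have [n [i ni]] := reach d.
  have ilt : (i + i.+1 < (n + i).+1 + (n + i).+1)%N by lia.
  (* Read at time n + i + 1, the symbol at d is the one at S^n d = S^i d0 read
     at time i + 1, which is the symbol at d0 read at time i + (i + 1). *)
  exists (n + i).+1, (fun w => w (Ordinal ilt) == v).
  rewrite [X in m X](_ : _ = set0) ?measure0//.
  apply/seteqP; split=> x //; rewrite /code_error/= ffunE /= => /negP[].
  have -> : b (iter (i + i.+1) f x) = c d (iter (n + i.+1) f x).
    by rewrite /b !iterD c_iter -ni -c_iter.
  rewrite -iterS -addnS; apply/eqP; apply/idP/eqP => [h|h]; first exact: (set_mem h).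
  exact: mem_set.
by apply: codableC.
Qed.

Lemma codable_measurable (m : probability (borel T) R) :
  invariant_measure m (f : borel T -> borel T) ->
  forall A, measurable A ->
    codable m (f : borel T -> borel T) (b : borel T -> bool) A.
Proof.
move=> invm A mA.
have mb : finite_rv (b : borel T -> bool) by exact: measurable_code.
have ms := measurable_shift.
suff : (<<s range (cyl c) >> : set (set (borel T))) `<=`
    [set B | measurable B /\ codable m (f : borel T -> borel T) b B].
  by move=> /(_ A); rewrite -(borel_cylE codc) => /(_ mA)[].
apply: smallest_sub; last first.
  by move=> _ [l _ <-]; split; [exact: measurable_cyl|exact: codable_cyl].
split.
- split=> // e e0; exists 0%N, (fun=> false).
  rewrite [X in m X](_ : _ = set0) ?measure0//.
  by apply/seteqP; split=> x //; rewrite /code_error/= in_set0.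
- move=> B [mB cB]; rewrite setTD; split; first exact: measurableC.
  exact: codableC.
- move=> B h; split; first by apply: bigcup_measurable => k _; exact: (h k).1.
  by apply: codable_bigcup => // k; [exact: (h k).1|exact: (h k).2].
Qed.

(** The words of length [n] have entropy at least [n * ln 2], by comparison
    with the fair measure and [entropy_le_block], and that is the logarithm of
    their number. *)
Theorem maximal_entropy_uniform (m : probability (borel T) R) n w :
  maximal_entropy_measure m (f : borel T -> borel T) ->
  m [set x | forall i, (i < n)%N -> c (iter i S d0) x = w i] = (2^-1 ^+ n)%:E.
Proof.
move=> [invm maxm]; case: n => [|N].
  rewrite expr0 -(@probability_setT _ _ _ m); congr (m _).
  by apply/seteqP; split.
have mb : finite_rv (b : borel T -> bool) by exact: measurable_code.
have [m' fm'] := fair_system.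
have := maxm m' (fair_invariant fm').
move=> /(le_trans (fair_entropy fm')) => lnm.
have := entropy_le_block measurable_shift invm mb (codable_measurable invm) N.
move=> /(le_trans lnm); rewrite lee_fin ler_pdivlMr ?ltr0Sn// => hN.
have mn : finite_rv (name (T := borel T) f b N.+1).
  by apply: finite_rv_name => //; exact: measurable_shift.
have cE : #|{ffun 'I_N.+1 -> bool}| = (2 ^ N.+1)%N.
  by rewrite card_ffun card_bool card_ord.
have hln : ln #|{ffun 'I_N.+1 -> bool}|%:R <= shannon_entropy m
    (fun u => name (T := borel T) f b N.+1 @^-1` [set u]).
  by rewrite cE natrX lnXn// -[ln 2 *+ _]mulr_natr.
have := entropy_max_uniform mn hln [ffun i : 'I_N.+1 => w i].
rewrite /law cE natrX -exprVn => lawE.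
rewrite [X in m X](_ : _ = name (T := borel T) f b N.+1 @^-1` [set [ffun i : 'I_N.+1 => w i]]).
  by rewrite -lawE fineK// fin_num_measure//; exact: mn.
apply/seteqP; split=> x /=.
  by move=> h; apply/ffunP => i; rewrite !ffunE /b c_iter h.
by move=> /ffunP h i iN; have := h (Ordinal iN); rewrite !ffunE /b c_iter.
Qed.
End coded_shift.

(** * The logistic map in the angle coordinate *)

Section angle.
Variable R : realType.
Implicit Types a b s t x y : R.

Lemma cos_lipschitz a b : `|cos a - cos b| <= `|a - b|.
Proof.
wlog ab : a b / a <= b.
  by move=> h; have [/h//|/ltW/h] := leP a b; rewrite distrC (distrC b).
have cs x : x \in `]a, b[ -> is_derive x 1 cos (- sin x) by move=> _; exact: is_derive_cos.
have cc : {within `[a, b], continuous (@cos R)}.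
  by apply: continuous_subspaceT => x; exact: continuous_cos.
have [c _ e] := MVT_segment ab cs cc.
rewrite distrC e normrM normrN (distrC a) ler_piMl// sin_max//.
Qed.

Lemma sin_sub a b : sin a - sin b = 2 * (cos ((a + b) / 2) * sin ((a - b) / 2)).
Proof.
rewrite -[in LHS](subrK b a).
have -> : a - b + b = (a + b) / 2 + (a - b) / 2 by field.
have -> : sin b = sin ((a + b) / 2 - (a - b) / 2) by congr sin; field.
by rewrite sinD sinB; ring.
Qed.

(** The map sending [s] to [asin (k * sin s)] has derivative
    [k * cos s / Num.sqrt (1 - k ^+ 2 * sin s ^+ 2)], at most 1 when
    [k <= 1]. This version avoids derivatives: if [a - b] were larger than
    [s - t], the product formula for [sin a - sin b], whose midpoint
    [(a + b) / 2] is at most [(s + t) / 2], would give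
    [sin a - sin b > sin s - sin t], against
    [sin a - sin b = k * (sin s - sin t)]. *)
Lemma sin_contraction (k a b s t : R) : 0 <= k <= 1 ->
  0 <= a <= pi / 2 -> 0 <= b <= pi / 2 -> 0 <= s <= pi / 2 -> 0 <= t <= pi / 2 ->
  sin a = k * sin s -> sin b = k * sin t -> `|a - b| <= `|s - t|.
Proof.
wlog ab : a b s t / b <= a.
  move=> h k01 a0 b0 s0 t0 sa sb; have [ba|/ltW ba] := leP b a; first exact: h.
  by rewrite distrC (distrC s); exact: h.
move=> /andP[k0 k1] /andP[a0 a1] /andP[b0 b1] /andP[s0 s1] /andP[t0 t1] sa sb.
have p0 : 0 < pi / 2 :> R by rewrite divr_gt0// pi_gt0.
have mono u v : 0 <= u -> u <= pi / 2 -> 0 <= v -> v <= pi / 2 ->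
    (sin u < sin v) = (u < v).
  by move=> *; apply: ltr_sin; rewrite in_itv/=; apply/andP; split; lra.
have shrink u v : 0 <= u -> u <= pi / 2 -> 0 <= v -> v <= pi / 2 ->
    sin u = k * sin v -> u <= v.
  move=> u0 u1 v0 v1 uv; rewrite leNgt -mono// -leNgt uv ler_piMl//.
  by rewrite sin_ge0_pi//; apply/andP; split; lra.
have as_ := shrink _ _ a0 a1 s0 s1 sa.
have bt := shrink _ _ b0 b1 t0 t1 sb.
rewrite ger0_norm ?subr_ge0//; rewrite leNgt; apply/negP => h.
have ts : t <= s.
  rewrite leNgt -mono//; apply/negP => st.
  have : sin a <= sin b by rewrite sa sb ler_wpM2l// ltW.
  rewrite leNgt mono// => /negP; apply; rewrite lt_neqAle ab andbT.
  apply/negP => /eqP e; move: h; rewrite e subrr; apply/negP; rewrite -leNgt.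
  exact: normr_ge0.
rewrite ger0_norm ?subr_ge0// in h.
have h1 : sin ((s - t) / 2) < sin ((a - b) / 2).
  by rewrite mono; lra.
have h2 : cos ((s + t) / 2) <= cos ((a + b) / 2).
  rewrite leNgt ltr_cos ?in_itv/=; last 2 first.
  - by apply/andP; split; lra.
  - by apply/andP; split; lra.
  by rewrite -leNgt; lra.
have h3 : 0 < cos ((a + b) / 2).
  by apply: cos_gt0_pihalf; apply/andP; split; lra.
have h4 : 0 <= sin ((s - t) / 2).
  by rewrite sin_ge0_pi//; apply/andP; split; lra.
have h5 : sin s - sin t < sin a - sin b.
  rewrite !sin_sub ltr_pM2l//.
  apply: (@le_lt_trans _ _ (cos ((a + b) / 2) * sin ((s - t) / 2))).
    by rewrite ler_wpM2r.
  by rewrite ltr_pM2l.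
have h6 : sin a - sin b <= sin s - sin t.
  rewrite sa sb -mulrBr ler_piMl// subr_ge0.
  by rewrite leNgt mono// -leNgt.
lra.
Qed.

(** The angle [t] in [0, pi] with [x = sin (t / 2) ^+ 2]. *)
Definition angle x : R := acos (1 - 2 * x).

Section bounds.
Variable x : R.
Hypothesis x01 : 0 <= x <= 1.

Let dx01 : -1 <= 1 - 2 * x <= 1.
Proof. by case/andP: x01 => *; apply/andP; split; lra. Qed.

Lemma angle_itv : 0 <= angle x <= pi.
Proof. by rewrite acos_ge0 ?acos_lepi. Qed.

Lemma cos_angle : cos (angle x) = 1 - 2 * x.
Proof. by rewrite acosK// in_itv. Qed.

Lemma sqr_sin_angle : sin (angle x) ^+ 2 = 4 * (x * (1 - x)).
Proof. by rewrite sin2cos2 cos_angle; ring. Qed.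

Lemma sqr_sin_half_angle : sin (angle x / 2) ^+ 2 = x.
Proof.
have := cos_mulr2n (angle x / 2).
rewrite (_ : angle x / 2 *+ 2 = angle x); last by rewrite -[LHS]mulr_natr divfK.
rewrite cos_angle cos2sin2 mulr2n; lra.
Qed.

Lemma angle_lt_pihalf : (angle x < pi / 2) = (x < 1 / 2).
Proof.
rewrite -ltr_cos ?in_itv/= ?angle_itv//.
  by rewrite cos_pihalf cos_angle; apply/idP/idP; lra.
by have := @pi_gt0 R => p0; apply/andP; split; lra.
Qed.
End bounds.

Lemma angle_dist x y : 0 <= x <= 1 -> 0 <= y <= 1 ->
  `|x - y| <= `|angle x - angle y|.
Proof.
move=> x01 y01; have := cos_lipschitz (angle x) (angle y).
rewrite !cos_angle// (_ : 1 - 2 * x - (1 - 2 * y) = 2 * (y - x)); last by ring.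
rewrite normrM (distrC y) ger0_norm// => h; apply: le_trans h.
by rewrite ler_peMl// ler1n.
Qed.

(** With [t] the angle of [x], [logistic nu x = nu / 4 * sin t ^+ 2], which is
    also the squared sine of half the angle of [logistic nu x]. *)
Lemma logistic_angle (nu x : R) : 4 < nu -> 0 <= x <= 1 ->
  0 <= logistic nu x <= 1 ->
  sin (angle x) = 2 / Num.sqrt nu * sin (angle (logistic nu x) / 2).
Proof.
move=> nu4 x01 Fx01.
have snu : 0 < Num.sqrt nu by rewrite sqrtr_gt0; lra.
have s1 : 0 <= sin (angle x) by rewrite sin_ge0_pi// angle_itv.
have s2 : 0 <= 2 / Num.sqrt nu * sin (angle (logistic nu x) / 2).
  rewrite mulr_ge0 ?divr_ge0 ?(ltW snu)// sin_ge0_pi//.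
  by case/andP: (angle_itv Fx01) => h1 h2; apply/andP; split; lra.
apply/eqP; rewrite -(eqrXn2 (n := 2)) //.
rewrite exprMn sqr_sin_half_angle// sqr_sin_angle// expr_div_n sqr_sqrtr; last lra.
by apply/eqP; rewrite /logistic; field; lra.
Qed.

(** By [logistic_angle] with [2 / Num.sqrt nu < 1], the angle on one side of
    1/2 is a contraction of half of the image angle; the other side is its
    mirror image under [t] to [pi - t]. *)
Lemma logistic_contraction (nu x y : R) : 4 < nu ->
  0 <= x <= 1 -> 0 <= logistic nu x <= 1 ->
  0 <= y <= 1 -> 0 <= logistic nu y <= 1 ->
  (x < 1 / 2) = (y < 1 / 2) ->
  `|angle x - angle y| <= `|angle (logistic nu x) - angle (logistic nu y)| / 2.
Proof.
move=> nu4 x01 Fx01 y01 Fy01 xy.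
have snu : 2 < Num.sqrt nu.
  rewrite -(@ltr_pXn2r _ 2)// ?nnegrE ?sqrtr_ge0// sqr_sqrtr; lra.
have k01 : 0 <= 2 / Num.sqrt nu <= 1.
  by rewrite divr_ge0 ?sqrtr_ge0//= ler_pdivrMr; lra.
have half (z : R) : 0 <= z <= 1 -> 0 <= angle z / 2 <= pi / 2.
  by move=> /angle_itv/andP[h1 h2]; apply/andP; split; lra.
rewrite -[X in _ / X]ger0_norm// -normf_div.
rewrite (_ : (angle (logistic nu x) - angle (logistic nu y)) / 2 =
  angle (logistic nu x) / 2 - angle (logistic nu y) / 2); last by field.
case/andP: (angle_itv x01) => ax0 ax1; case/andP: (angle_itv y01) => ay0 ay1.
have ex := logistic_angle nu4 x01 Fx01.
have ey := logistic_angle nu4 y01 Fy01.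
have [x2|x2] := ltP x (1 / 2).
  have y2 : y < 1 / 2 by rewrite -xy.
  apply: (sin_contraction k01 _ _ (half _ Fx01) (half _ Fy01) ex ey).
  - by rewrite ax0 ltW// angle_lt_pihalf.
  - by rewrite ay0 ltW// angle_lt_pihalf.
have y2 : 1 / 2 <= y by rewrite leNgt -xy -leNgt.
have ax : pi / 2 <= angle x by rewrite leNgt angle_lt_pihalf// -leNgt.
have ay : pi / 2 <= angle y by rewrite leNgt angle_lt_pihalf// -leNgt.
have sinp (z : R) : sin (pi - z) = sin z.
  by rewrite sinB sinpi cospi mul0r mulN1r opprK add0r.
rewrite (_ : angle x - angle y = (pi - angle y) - (pi - angle x)); last by ring.
rewrite distrC.
move: ex ey; rewrite -(sinp (angle x)) -(sinp (angle y)) => ex ey.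
apply: (sin_contraction k01 _ _ (half _ Fx01) (half _ Fy01) ex ey);
  by apply/andP; split; lra.
Qed.

End angle.

(** * Symbolic dynamics on Lambda *)

Section dynamics.
Context (R : realType) (nu : R) (nu_gt4 : 4 < nu).
Local Notation F := (logistic nu).
Local Notation L := (Lambda nu).

Lemma LambdaP x : L x <-> 0 <= x <= 1 /\ L (F x).
Proof.
split=> [Lx|[x01 LFx]].
  by split; [have := Lx 0%N I; rewrite /= in_itv|exact: logistic_Lambda].
move=> [|n] _ /=; first by rewrite in_itv.
by have := LFx n I; rewrite /preimage/= -iterS iterSr.
Qed.

Lemma Lambda_itv x : L x -> 0 <= x <= 1. Proof. by move=> /LambdaP[]. Qed.

Lemma Lambda_iter n x : L x -> L (iter n F x).
Proof. by move=> Lx; elim: n => //= n; exact: logistic_Lambda. Qed.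

Lemma Lambda0 : L 0.
Proof.
have F0 : F 0 = 0 by rewrite /logistic mulr0 mul0r.
by move=> n _; rewrite /= (_ : iter n F 0 = 0) ?in_itv/= ?lexx ?ler01//; elim: n => //= n ->.
Qed.

Lemma Lambda1 : L 1.
Proof.
apply/LambdaP; split; first by rewrite ler01 lexx.
by rewrite /logistic subrr mulr0; exact: Lambda0.
Qed.

(** The two solutions of [F x = y] are symmetric about 1/2, at distance half
    the square root of [1 - 4 * y / nu], and this is positive because
    [nu > 4]. *)
Lemma Lambda_preimage y (v : bool) : L y ->
  exists x, [/\ L x, F x = y & (x < 1 / 2) = v].
Proof.
move=> Ly; have /andP[y0 y1] := Lambda_itv Ly; have nu4 := nu_gt4.
have nup : 0 < nu by rewrite (lt_trans _ nu_gt4).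
have nu0 : nu != 0 by rewrite gt_eqF.
have d0 : 0 < 1 - 4 * y / nu.
  by rewrite subr_gt0 ltr_pdivrMr; lra.
have d1 : 1 - 4 * y / nu <= 1 by rewrite gerBl divr_ge0// ?mulr_ge0//; lra.
pose s := Num.sqrt (1 - 4 * y / nu).
have s0 : 0 < s by rewrite sqrtr_gt0.
have s1 : s <= 1 by rewrite -[leRHS]sqrtr1 ler_wsqrtr.
have s2 : s ^+ 2 = 1 - 4 * y / nu by rewrite sqr_sqrtr// ltW.
have Fs (e : R) : e ^+ 2 = 1 -> F ((1 + e * s) / 2) = y.
  move=> e1; rewrite /logistic.
  have -> : nu * ((1 + e * s) / 2) * (1 - (1 + e * s) / 2) =
    nu * (1 - e ^+ 2 * s ^+ 2) / 4 by field.
  by rewrite e1 s2; field.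
exists ((1 + (if v then -1 else 1) * s) / 2).
have FE : F ((1 + (if v then -1 else 1) * s) / 2) = y.
  by apply: Fs; case: v; rewrite ?sqrrN expr1n.
split=> //; last by case: v {FE}; [apply/idP|apply/negbTE; rewrite -leNgt]; lra.
apply/LambdaP; rewrite FE; split => //.
by case: v {FE}; apply/andP; split; lra.
Qed.

Lemma logistic_Lambda_onto : F @` L = L.
Proof.
apply/seteqP; split=> [_ [x Lx <-]|y /(Lambda_preimage true)[x [Lx Fx _]]].
  exact: logistic_Lambda.
by exists x.
Qed.

Lemma continuous_logistic : continuous F.
Proof.
move=> x; apply: continuousM; last by apply: continuousB; [exact: cst_continuous|].
by apply: continuousM; [exact: cst_continuous|].
Qed.

Lemma continuous_iter n : continuous (iter n F).
Proof.
elim: n => [|n IH] x //=.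
by apply: (@continuous_comp _ _ _ (iter n F) F); [exact: IH|exact: continuous_logistic].
Qed.

Lemma closed_Lambda : closed L.
Proof.
apply: closed_bigI => n _.
have := proj1 (continuous_closedP (iter n F)) (@continuous_iter n).
by apply; exact: interval_closed.
Qed.

Lemma compact_Lambda : compact L.
Proof.
apply: (subclosed_compact closed_Lambda (@segment_compact R 0 1)).
by move=> x /Lambda_itv x01; rewrite /= in_itv.
Qed.

Context (J : bool -> set R) (branchJ : branch_intervals nu J).
Local Notation h := (itinerary nu J).
Local Notation side x := (x < 1 / 2).

Let bit x : bool := x \in J true.

Lemma bitE x v : L x -> (bit x = v) <-> J v x.
Proof.
move=> Lx; have [Jitv J0 JE] := branchJ.
have : (J false `|` J true) x.
  rewrite -JE; split=> /=; first by rewrite in_itv Lambda_itv.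
  by rewrite in_itv; exact: (Lambda_itv (logistic_Lambda Lx)).
have disj : J false x -> J true x -> False.
  by move=> j0 j1; have : (J false `&` J true) x by []; rewrite J0.
rewrite /bit => Jx; case: v; split; first exact: set_mem.
- exact: mem_set.
- by move=> /negbT; rewrite notin_setE; case: Jx.
- by move=> j0; apply/negbTE; rewrite notin_setE => /(disj j0).
Qed.

(** An interval of [branch_intervals] cannot contain 1/2, whose image
    [nu / 4] exceeds 1; so it lies on one side of 1/2. *)
Lemma bit_side x y : L x -> L y -> bit x = bit y -> side x = side y.
Proof.
have [Jitv J0 JE] := branchJ.
have half v : ~ J v (1 / 2).
  move=> jv; have : (J false `|` J true) (1 / 2 : R) by case: v jv; [right|left].
  rewrite -JE => -[_]; rewrite /= in_itv/= /logistic => /andP[_]; have := nu_gt4; lra.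
suff lr u z : L u -> L z -> u < 1 / 2 -> 1 / 2 <= z -> bit u = bit z -> False.
  move=> Lx Ly xy; have [x2|x2] := ltP x; have [y2|y2] := ltP y => //.
    by have := lr _ _ Lx Ly x2 y2 xy.
  by have := lr _ _ Ly Lx y2 x2 (esym xy).
move=> Lu Lz u2 z2 uz.
have Ju : J (bit u) u by apply/bitE.
have Jz : J (bit u) z by rewrite uz; apply/bitE.
apply: (half (bit u)); apply: (Jitv (bit u) u z) => //.
by rewrite (ltW u2) z2.
Qed.

(** By [bit_side] the points 0 and 1 have different symbols, and a point on
    the left of 1/2 cannot share the symbol of 1, nor one on the right that of
    0. *)
Lemma side_bit x y : L x -> L y -> side x = side y -> bit x = bit y.
Proof.
have side0 : side (0 : R) by lra.
have side1 : ~ side (1 : R) by apply/negP; rewrite -leNgt; lra.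
have b01 : bit 0 != bit 1.
  apply/negP => /eqP /(bit_side Lambda0 Lambda1); rewrite side0.
  by move=> /esym/side1.
suff dich z : L z -> bit z = if side z then bit 0 else bit 1.
  by move=> Lx Ly xy; rewrite (dich x)// (dich y)// xy.
move=> Lz; case: ifPn => z2.
  have : bit z != bit 1.
    by apply/negP => /eqP /(bit_side Lz Lambda1); rewrite z2 => /esym/side1.
  by move: b01; case: (bit z); case: (bit 0); case: (bit 1).
have : bit z != bit 0.
  apply/negP => /eqP /(bit_side Lz Lambda0); rewrite (negbTE z2) side0.
  by [].
by move: b01; case: (bit z); case: (bit 0); case: (bit 1).
Qed.

Lemma bit_preimage y v : L y -> exists x, [/\ L x, F x = y & bit x = v].
Proof.
move=> Ly; have [x [Lx Fx sx]] := Lambda_preimage true Ly.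
have [z [Lz Fz sz]] := Lambda_preimage false Ly.
have xz : bit x != bit z by apply/negP => /eqP /(bit_side Lx Lz); rewrite sx sz.
have [e|ne] := eqVneq (bit x) v; first by exists x.
by exists z; split=> //; move: xz ne; case: (bit x); case: (bit z); case: v.
Qed.

(** Each common symbol halves the distance of the angles, which is at most
    [pi] to begin with. *)
Lemma agree_dist n x y : L x -> L y -> (forall i, (i < n)%N -> h x i = h y i) ->
  `|x - y| <= 2^-1 ^+ n * pi.
Proof.
move=> Lx Ly xy; apply: (le_trans (angle_dist (Lambda_itv Lx) (Lambda_itv Ly))).
elim: n x y Lx Ly xy => [|n IH] x y Lx Ly xy.
  have /andP[a1 a2] := angle_itv (Lambda_itv Lx).
  have /andP[b1 b2] := angle_itv (Lambda_itv Ly).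
  by rewrite expr0 mul1r ler_norml; apply/andP; split; lra.
have LFx := logistic_Lambda Lx; have LFy := logistic_Lambda Ly.
have sxy := bit_side Lx Ly (xy 0%N (ltn0Sn _)).
apply: (le_trans (logistic_contraction nu_gt4 (Lambda_itv Lx) (Lambda_itv LFx)
  (Lambda_itv Ly) (Lambda_itv LFy) sxy)).
have := IH _ _ LFx LFy; rewrite exprS => h1.
have {}h1 := h1 _; rewrite mulrC -mulrA ler_pM2l ?invr_gt0//; apply: h1 => i iN.
by have := xy i.+1 iN; rewrite /itinerary !iterSr.
Qed.

Lemma small_pow (e : R) : 0 < e -> exists n, 2^-1 ^+ n * pi < e.
Proof.
move=> e0; have p0 := @pi_gt0 R.
have [n ne] : exists n, 2^-1 ^+ n < e / pi.
  have : (fun n => (2^-1 : R) ^+ n) @ \oo --> 0.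
    by apply: cvg_expr; rewrite ger0_norm; lra.
  move=> /cvgr_lt /(_ (e / pi)); rewrite divr_gt0// => /(_ isT)[n _ /(_ n (leqnn n))].
  by exists n.
by exists n; rewrite -ltr_pdivlMr.
Qed.

Lemma itinerary_inj : {in L &, injective h}.
Proof.
move=> x y /set_mem Lx /set_mem Ly xy; apply/eqP; rewrite -subr_eq0 -normr_le0.
apply/ler_addgt0Pr => e /small_pow[n ne]; rewrite add0r.
apply: le_trans (ltW ne).
by apply: agree_dist => // i _; rewrite xy.
Qed.

Lemma itinerary_prefix n (s : nat -> bool) z : L z ->
  exists x, [/\ L x, iter n F x = z & forall i, (i < n)%N -> h x i = s i].
Proof.
elim: n s => [|n IH] s Lz; first by exists z.
have [y [Ly yz ys]] := IH (fun i => s i.+1) Lz.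
have [x [Lx Fx bx]] := bit_preimage (s 0%N) Ly.
exists x; split => //; first by rewrite iterSr Fx.
move=> [|i] iN; first exact: bx.
by rewrite /itinerary iterSr Fx; exact: ys.
Qed.

(** The [k]-th symbol tells on which side of 1/2 the [k]-th iterate lies, and
    no iterate is 1/2; so it is locally constant on [Lambda nu]. *)
Lemma itinerary_near x k : L x ->
  \forall y \near x, L y -> h y k = h x k.
Proof.
move=> Lx; have Lkx := Lambda_iter k Lx.
have Fh y : L y -> y != 1 / 2.
  move=> Ly; apply/eqP => e; have := Lambda_itv (logistic_Lambda Ly).
  by rewrite e /logistic => /andP[_]; have := nu_gt4; lra.
have : \forall z \near iter k F x, side z = side (iter k F x).
  case: (ltrgtP (iter k F x) (1 / 2)) => [x2|x2|e].
  - near=> z; near: z; exact: lt_nbhsl.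
  - near=> z; apply/negbTE; rewrite -leNgt ltW//; near: z; exact: lt_nbhsr.
  - by have := Fh _ Lkx; rewrite e eqxx.
move=> /(@continuous_iter k x) nx.
have : \forall y \near x, side (iter k F y) = side (iter k F x) by exact: nx.
apply: filterS => y sy Ly.
exact: (side_bit (Lambda_iter k Ly) Lkx sy).
Unshelve. all: by end_near. Qed.

(** Points with the right first [n] symbols exist for every [n]; by compactness
    they accumulate at a point of [Lambda nu], which has all the right symbols
    because each of them is locally constant. *)
Lemma itinerary_surj (s : cantor_space) : exists2 x, L x & h x = s.
Proof.
have /choice[u hu] : forall n, exists x, L x /\ forall i, (i < n)%N -> h x i = s i.
  by move=> n; have [x [Lx _ xs]] := itinerary_prefix n s Lambda0; exists x.
have [|x [Lx clx]] := @compact_Lambda (u n @[n --> \oo]) _.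
  by exists 0%N => // n _ /=; exact: (hu n).1.
exists x => //; apply/funext => k.
have A : (u n @[n --> \oo]) [set u n | n in [set n | (k < n)%N]].
  by exists k.+1 => // n kn; exists n.
have [_ [[n kn <-] /(_ (hu n).1) <-]] := clx _ _ A (itinerary_near k Lx).
exact: (hu n).2.
Qed.

End dynamics.

(** * The inverse of the itinerary map *)

Section coded_reals.
Context (D : countType) (T : ptopologicalType) (c : D -> T -> bool).
Hypothesis codc : coding c.

Lemma measurable_fun_locally_coded (R : realType) (phi : borel T -> R) :
  (forall O : set R, open O -> locally_coded c (phi @^-1` O)) ->
  measurable_fun setT phi.
Proof.
move=> h; apply: (measurability _ (RGenOpens.measurableE R)).
move=> _ [_ [x [y ->]] <-]; rewrite setTI.
rewrite (borel_cylE codc); apply: locally_coded_borel; apply: h.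
exact: itv_open.
Qed.

Lemma measurable_fun_continuous (R : realType) (phi : T -> R) :
  continuous phi -> measurable_fun setT (phi : borel T -> R).
Proof.
move=> /continuousP cphi; apply: measurable_fun_locally_coded => O oO.
exact/codc.2/cphi.
Qed.

End coded_reals.

Section inverse_limit.
Context (R : realType) (nu : R) (nu_gt4 : 4 < nu).
Context (J : bool -> set R) (branchJ : branch_intervals nu J).
Local Notation F := (logistic nu).
Local Notation L := (Lambda nu).
Local Notation h := (itinerary nu J).
Local Notation hinv := (itinerary_inv nu J).

Let h_onto (s : cantor_space) : (h @` L) s.
Proof. by have [x Lx hx] := itinerary_surj nu_gt4 branchJ s; exists x. Qed.

Lemma itinerary_invK s : h (hinv s) = s.
Proof. by apply: pinvK; exact/mem_set/h_onto. Qed.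

Lemma itineraryK x : L x -> hinv (h x) = x.
Proof.
move=> Lx; rewrite /itinerary_inv pinvKV ?inE//.
exact: (itinerary_inj nu_gt4 branchJ).
Qed.

Lemma Lambda_itinerary_inv s : L (hinv s).
Proof. by have [x Lx <-] := h_onto s; rewrite itineraryK. Qed.

(** By [agree_dist], finitely many symbols determine the point up to any
    prescribed precision. *)
Lemma measurable_itinerary_inv :
  measurable_fun setT (hinv : borel cantor_space -> R).
Proof.
apply: (measurable_fun_locally_coded coding_symbol) => O oO s Os.
have [e /= e0 eO] := (nbhs_ballP (hinv s) O).1 (open_nbhs_nbhs (conj oO Os)).
have [n ne] := small_pow e0.
exists (iota 0 n) => t ts; apply: eO; rewrite /ball/=; apply: le_lt_trans ne.
apply: (agree_dist nu_gt4 branchJ); try exact: Lambda_itinerary_inv.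
by move=> i iN; rewrite !itinerary_invK; apply/esym/(ts i); rewrite mem_iota.
Qed.

(** [Lambda nu] has no isolated point since changing one far symbol moves a
    point by little, it is compact as a closed part of [0, 1], and the value of
    a symbol gives a clopen set separating two points. *)
Lemma cantor_like_Lambda : cantor_like L.
Proof.
split.
- split; first exact: closedT.
  apply/seteqP; split=> // x _ U /= [B [[V oV <-] Vx BU]].
  have Lx : L (val x) := set_valP x.
  have [e /= e0 eV] := (nbhs_ballP (val x) V).1 (open_nbhs_nbhs (conj oV Vx)).
  have [n ne] := small_pow e0.
  pose s : cantor_space := fun k => if k == n then ~~ h (val x) n else h (val x) k.
  have Ls := Lambda_itinerary_inv s.
  exists (exist _ (hinv s) (mem_set Ls)); split => //.
    apply/eqP => /(congr1 val)/= e'.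
    have : h (hinv s) n = h (val x) n by rewrite e'.
    by rewrite itinerary_invK /s eqxx; case: (h _ n).
  apply: BU; apply: eV; rewrite /ball/=; apply: le_lt_trans ne.
  apply: (agree_dist nu_gt4 branchJ) => // i iN.
  by rewrite itinerary_invK /s ltn_eqF.
- move=> G PG GT.
  have [|p [Lp clp]] := @compact_Lambda R nu (val @ G) _.
    have GL : G [set x : L | L (val x)].
      by apply: filterS GT => x _; exact: (set_valP x).
    exact: GL.
  exists (exist _ p (mem_set Lp)); split => // A B GA [B' [[V oV <-] Vp VB]].
  have [_ [[x Ax <-] Vx]] : (val @` A) `&` V !=set0.
    have GA' : G [set x : L | (val @` A) (val x)].
      by apply: filterS GA => x Ax; exists x.
    by apply: (clp _ _ GA'); exact: open_nbhs_nbhs.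
  by exists x; split => //; exact: VB.
- move=> p q clpq; apply: val_inj; apply: (@Rhausdorff R) => A B nA nB.
  have [x [Ax Bx]] := clpq (val @^-1` A) (val @^-1` B)
    (initial_continuous nA) (initial_continuous nB).
  by exists (val x).
- move=> x y xy.
  have Lx : L (val x) := set_valP x. have Ly : L (val y) := set_valP y.
  have [k hk] : exists k, h (val x) k <> h (val y) k.
    apply/not_existsP => hk; case/negP: xy; apply/eqP/val_inj.
    apply: (itinerary_inj nu_gt4 branchJ); rewrite ?inE//.
    by apply/funext => k; apply: contrapT; exact: hk.
  have op v : open [set z : L | h (val z) k = v].
    rewrite openE => z /= zv.
    have Lz : L (val z) := set_valP z.
    have nz : nbhs z (val @^-1` [set w | L w -> h w k = h (val z) k]).
      by apply: initial_continuous; exact: (itinerary_near nu_gt4 branchJ).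
    apply: filterS nz => w /= ->//; exact: (set_valP w).
  exists [set z : L | h (val z) k = h (val x) k]; split => //; last exact/nesym.
  split => //; rewrite -openC.
  rewrite (_ : ~` _ = [set z : L | h (val z) k = ~~ h (val x) k])//.
  apply/seteqP; split=> z /=; first by case: (h _ k); case: (h _ k).
  by move=> ->; case: (h _ k).
Qed.

End inverse_limit.

(** * The inverse limit as a two-sided shift *)

Section inverse_limit_coding.
Context (R : realType) (nu : R) (J : bool -> set R).
Local Notation F := (logistic nu).
Local Notation L := (Lambda nu).
Local Notation h := (itinerary nu J).
Local Notation hinv := (itinerary_inv nu J).
Local Notation hL := (hLambda nu).

(** The future symbols come from the itinerary of [x_0], the symbol at [-i] is
    the first symbol of [x_{-i}]. *)
Definition bicode (n : int) (x : hL) : bool :=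
  match n with
  | Posz i => h (hcoord x 0) i
  | Negz i => hcoord x i.+1 \in J true
  end.

Lemma hcoord_Lambda (x : hL) i : L (hcoord x i).
Proof. by have [Lx _] : inv_limit nu (val x) := set_valP x; exact: Lx. Qed.

Lemma hcoordS (x : hL) i : F (hcoord x i.+1) = hcoord x i.
Proof. by have [_ Fx] : inv_limit nu (val x) := set_valP x; exact: Fx. Qed.

Lemma hcoord_iter (x : hL) n i : iter n F (hcoord x (n + i)) = hcoord x i.
Proof. by elim: n => // n IH; rewrite iterSr hcoordS. Qed.

(** Since [x_{-m}] is mapped to [x_0] in [m] steps, its itinerary is the
    symbol sequence read from index [-m] on. *)
Lemma itinerary_hcoord (x : hL) m i : h (hcoord x m) i = bicode (i%:Z - m%:Z) x.
Proof.
have [mi|im] := leqP m i.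
  rewrite subzn//= /itinerary -[in LHS](subnK mi) iterD.
  by rewrite -[m in hcoord x m]addn0 hcoord_iter.
have -> : i%:Z - m%:Z = Negz (m - i.+1) by lia.
by rewrite /= /itinerary -[in LHS](subnKC (ltnW im)) hcoord_iter subnSK.
Qed.

Lemma hcoord_hshift (x : hL) i : hcoord (hshift x) i.+1 = hcoord x i.
Proof. by []. Qed.

Lemma bicode_hshift n (x : hL) : bicode n (hshift x) = bicode (n + 1) x.
Proof.
have [i [m nE]] : exists i m : nat, n = i%:Z - m.+1%:Z.
  case: n => [n|n]; first by exists n.+1, 0%N; lia.
  by exists 0%N, n; lia.
rewrite nE -itinerary_hcoord hcoord_hshift itinerary_hcoord.
by congr (bicode _ x); lia.
Qed.

Lemma continuous_hcoord i : continuous (fun x : hL => hcoord x i).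
Proof.
move=> x; apply: (@continuous_comp _ _ _ (fun x : hL => val x : {ptws nat -> R})
  (fun y : {ptws nat -> R} => y i)); last exact: ptws_eval_continuous.
exact: initial_continuous.
Qed.

Lemma itinerary_agree n k (x y : hL) :
  (forall d, d \in [seq i%:Z - n%:Z | i <- iota 0 (n + k)] -> bicode d y = bicode d x) ->
  forall j, (j <= n)%N -> forall i, (i < k)%N -> h (hcoord y j) i = h (hcoord x j) i.
Proof.
move=> yx j jn i ik; rewrite !itinerary_hcoord.
have -> : i%:Z - j%:Z = (n - j + i)%N%:Z - n%:Z by lia.
by apply: yx; apply: map_f; rewrite mem_iota; lia.
Qed.

Hypotheses (nu_gt4 : 4 < nu) (branchJ : branch_intervals nu J).

(** An open set of the product topology restricts finitely many coordinates
    with finite precision; by [agree_dist] that is implied by finitely many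
    symbols of these coordinates, which lie in one finite range of indices. *)
Lemma coding_bicode : coding bicode.
Proof.
split=> [d v|B oB]; last case: oB => O oO <- x Ox.
  rewrite openE => x /= xv.
  have [i [m dE]] : exists i m : nat, d = i%:Z - m%:Z.
    by case: d {xv} => n; [exists n, 0%N|exists 0%N, n.+1]; lia.
  have : \forall y \near hcoord x m, L y -> h y i = h (hcoord x m) i.
    exact: (itinerary_near nu_gt4 branchJ _ (hcoord_Lambda x m)).
  move=> /(@continuous_hcoord m x) nx.
  have : \forall y \near x, L (hcoord y m) -> h (hcoord y m) i = h (hcoord x m) i.
    exact: nx.
  apply: filterS => y /= /(_ (hcoord_Lambda y m)).
  by rewrite !itinerary_hcoord -dE xv.
have [n [A [nA AO]]] := nbhs_ptws (open_nbhs_nbhs (conj oO Ox)).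
have /choice[k hk] : forall i, exists k, forall y, L y ->
    (forall j, (j < k)%N -> h y j = h (hcoord x i) j) -> A i y.
  move=> i; have [e /= e0 eA] := (nbhs_ballP _ (A i)).1 (nA i).
  have [k ke] := small_pow e0; exists k => y Ly yx.
  apply: eA; rewrite /ball/=; apply: le_lt_trans ke.
  apply: (agree_dist nu_gt4 branchJ) => //; first exact: hcoord_Lambda.
  by move=> j jk; rewrite yx.
pose K := \max_(i < n) k i.
exists [seq i%:Z - n%:Z | i <- iota 0 (n + K)] => y yx; apply: AO => i iN.
apply: hk; first exact: hcoord_Lambda.
move=> j jk; apply: (itinerary_agree yx); first exact: ltnW.
by apply: (leq_trans jk); exact: (@leq_bigmax _ (fun i : 'I_n => k i) (Ordinal iN)).
Qed.

(** The point [x_{-j}] is the one whose itinerary is [s] read from index [-j]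
    on; injectivity of the itinerary map shows that these points are
    compatible. *)
Lemma bicode_surj (s : int -> bool) : exists x, forall d, bicode d x = s d.
Proof.
pose u (j : nat) : R := hinv (fun i => s (i%:Z - j%:Z)).
have Lu j : L (u j) by exact: (Lambda_itinerary_inv nu_gt4 branchJ).
have Fu j : F (u j.+1) = u j.
  apply: (itinerary_inj nu_gt4 branchJ); rewrite ?inE//; first exact: logistic_Lambda.
  apply/funext => i; rewrite /itinerary -iterSr -!/(itinerary nu J _ _).
  rewrite !(itinerary_invK nu_gt4 branchJ); congr s; lia.
have iu : (u : {ptws nat -> R}) \in inv_limit nu by rewrite inE; split.
exists (exist _ u iu) => d.
have [i [m ->]] : exists i m : nat, d = i%:Z - m%:Z.
  by case: d => n; [exists n, 0%N|exists 0%N, n.+1]; lia.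
by rewrite -itinerary_hcoord /hcoord/= (itinerary_invK nu_gt4 branchJ).
Qed.

End inverse_limit_coding.

(** * Laws under the measures of maximal entropy *)

Section maximal_entropy_laws.
Context (R : realType) (nu : R) (nu_gt4 : 4 < nu).
Context (J : bool -> set R) (branchJ : branch_intervals nu J).

Lemma maximal_entropy_cantor (mu : probability (borel cantor_space) R) :
  maximal_entropy_measure mu shift2 -> fair symbol mu.
Proof.
move=> mumax; apply: fair_of_prefix => n w.
have iterE i : iter i S 0%N = i by elim: i => //= i ->.
have surj (s : nat -> bool) : exists x : cantor_space, forall d, symbol d x = s d.
  by exists s.
have shiftE d (x : cantor_space) : symbol d (shift2 x) = symbol d.+1 x by [].
have inj0 : injective (fun i => iter i S 0%N) by move=> i j; rewrite !iterE.
have reach d : exists m i, iter m S d = iter i S 0%N.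
  by exists 0%N, d; rewrite iterE.
rewrite -(maximal_entropy_uniform coding_symbol surj shiftE succn_inj inj0 reach
  n w mumax).
by congr (mu _); apply/seteqP; split=> s /= e i iN; have := e i iN; rewrite iterE.
Qed.

Lemma iter_int i (n : int) : iter i (fun k : int => k + 1) n = n + i%:Z.
Proof. by elim: i => [|i IH]; rewrite ?addr0//= IH; lia. Qed.

Lemma maximal_entropy_hLambda (mu0 : probability (borel (hLambda nu)) R) n w :
  maximal_entropy_measure mu0 (@hshift R nu) ->
  mu0 [set x | forall i, (i < n)%N -> itinerary nu J (hcoord x 0) i = w i] =
  (2^-1 ^+ n)%:E.
Proof.
move=> mumax.
have shiftE := @bicode_hshift R nu J.
have injS : injective (fun k : int => k + 1) by exact: addIr.
have inj0 : injective (fun i => iter i (fun k : int => k + 1) 0).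
  by move=> i j; rewrite !iter_int !add0r => -[].
have reach d : exists m i, iter m (fun k : int => k + 1) d = iter i (fun k : int => k + 1) 0.
  case: d => k; first by exists 0%N, k; rewrite !iter_int; lia.
  by exists k.+1, 0%N; rewrite !iter_int; lia.
rewrite -(maximal_entropy_uniform (coding_bicode nu_gt4 branchJ)
  (bicode_surj nu_gt4 branchJ) shiftE injS inj0 reach n w mumax).
congr (mu0 _); apply/seteqP; split=> s /= e i iN; have := e i iN;
  by rewrite iter_int add0r.
Qed.

Variables (mu0 : probability (borel (hLambda nu)) R).
Hypothesis mu0_max : maximal_entropy_measure mu0 (@hshift R nu).

Lemma measurable_hcoord i :
  measurable_fun setT ((fun x => hcoord x i) : borel (hLambda nu) -> R).
Proof.
apply: (measurable_fun_continuous (coding_bicode nu_gt4 branchJ)).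
exact: continuous_hcoord.
Qed.

(** After [i] shifts the coordinate [i] is the former coordinate 0. *)
Lemma law_hcoord i (B : set R) : measurable B ->
  mu0 [set x | B (hcoord x i)] = mu0 [set x | B (hcoord x 0)].
Proof.
move=> mB; have [invm _] := mu0_max.
have ms : measurable_fun setT (@hshift R nu : borel (hLambda nu) -> borel (hLambda nu)).
  exact: (measurable_shift (coding_bicode nu_gt4 branchJ) (@bicode_hshift R nu J)).
rewrite -(invariant_iter ms invm i); last first.
  by rewrite -[X in measurable X]setTI; exact: (measurable_hcoord i measurableT mB).
have hcoord_iter_hshift x : hcoord (iter i (@hshift R nu) x) i = hcoord x 0.
  by elim: i x => // k IH x; rewrite iterS hcoord_hshift IH.
by congr (mu0 _); apply/seteqP; split=> x; rewrite /preimage/= hcoord_iter_hshift.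
Qed.

Variables (mu : probability (borel cantor_space) R).
Hypothesis mu_max : maximal_entropy_measure mu shift2.

(** The law of the itinerary of [x_0] under [mu0] and [mu] both give mass
    [2^-1 ^+ n] to the prefixes of length [n], hence coincide. *)
Lemma law_itinerary_inv (B : set R) : measurable B ->
  mu (itinerary_inv nu J @^-1` B) = mu0 [set x | B (hcoord x 0)].
Proof.
move=> mB.
pose phi (x : hLambda nu) := itinerary nu J (hcoord x 0).
have mphi : measurable_fun setT (phi : borel (hLambda nu) -> borel cantor_space).
  apply: (measurable_fun_coding coding_symbol) => k v.
  by apply: sub_sigma_algebra; exact: ((coding_bicode nu_gt4 branchJ).1 (Posz k) v).
have [P PE] := pushforward_probability mu0 mphi.
have fP : fair symbol P.
  apply: fair_of_prefix => n w; rewrite PE -(maximal_entropy_hLambda n w mu0_max).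
  by [].
have fmu := maximal_entropy_cantor mu_max.
have mu_P : mu (itinerary_inv nu J @^-1` B) = P (itinerary_inv nu J @^-1` B).
  apply: (coding_measure_unique coding_symbol) => [l|].
    by rewrite (fair_cyl fmu) (fair_cyl fP).
  rewrite -[X in measurable X]setTI.
  exact: (measurable_itinerary_inv nu_gt4 branchJ measurableT mB).
rewrite mu_P PE; congr (mu0 _); apply/seteqP; split=> x; rewrite /preimage/= /phi.
  by rewrite (itineraryK nu_gt4 branchJ)//; exact: hcoord_Lambda.
by rewrite (itineraryK nu_gt4 branchJ)//; exact: hcoord_Lambda.
Qed.

End maximal_entropy_laws.

(** * Integration *)

Section integral_of_difference.
Local Open Scope ereal_scope.
Context (d : measure_display) (T : measurableType d) (R : realType).
Variables (m : probability T R) (D : set T) (g : T -> \bar R) (c : R).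
Hypotheses (mD : measurable D) (mg : measurable_fun D g).
Hypothesis g0 : forall x, D x -> 0 <= g x.

(** Additivity of the integral covers the case of a finite integral of [g].
    Otherwise the positive part of [c - g] is bounded by [`|c|] and its
    negative part is at least [g - `|c|], so both sides are [-oo]. *)
Lemma integral_cst_sub :
  \int[m]_(x in D) (c%:E - g x) = c%:E * m D - \int[m]_(x in D) g x.
Proof.
have mDfin : m D \is a fin_num by exact: fin_num_measure.
have ic : m.-integrable D (EFin \o cst c) by exact: finite_measure_integrable_cst.
have [a Ia] : exists a : R, \int[m]_(x in D) cst `|c|%:E x = a%:E.
  exists (`|c| * fine (m D))%R; rewrite (integral_cst m mD) EFinM.
  by congr (_ * _); exact/esym/fineK.
have [goo|goo] := eqVneq (\int[m]_(x in D) g x) +oo; last first.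
  have ig : m.-integrable D g.
    apply/integrableP; split => //.
    rewrite (eq_integral g); last by move=> x /set_mem Dx; rewrite gee0_abs// g0.
    by rewrite ltey.
  by rewrite (integralB mD ic ig); congr (_ - _);
    exact: (integral_cst m mD c%:E).
have mf : measurable_fun D (fun x => c%:E - g x).
  by apply: emeasurable_funB => //; exact: measurable_cst.
have negoo : \int[m]_(x in D) (fun x => c%:E - g x)^\- x = +oo.
  apply/eqP; rewrite -leye_eq.
  have : \int[m]_(x in D) g x <=
      \int[m]_(x in D) (`|c|%:E + (fun x => c%:E - g x)^\- x).
    apply: ge0_le_integral => //.
    - by apply: emeasurable_funD; [exact: measurable_cst|exact: measurable_funeneg].
    - move=> x Dx; apply: (@le_trans _ _ (`|c|%:E - (c%:E - g x))); last first.
        by apply: leeD2l; rewrite funenegE le_max lexx.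
      case: (g x) (g0 Dx) => [r|//|//] _.
      by rewrite -!EFinB lee_fin; have := ler_norm c; lra.
  rewrite goo ge0_integralD//; last exact: measurable_funeneg.
  rewrite [X in X + _]Ia !leye_eq.
  by case: (integral _ _ _).
have posfin : \int[m]_(x in D) (fun x => c%:E - g x)^\+ x \is a fin_num.
  rewrite ge0_fin_numE ?integral_ge0//.
  apply: (@le_lt_trans _ _ (\int[m]_(x in D) (cst `|c|%:E) x)).
    apply: ge0_le_integral => //; first exact: measurable_funepos.
    move=> x Dx; rewrite funeposE ge_max lee_fin normr_ge0 andbT.
    case: (g x) (g0 Dx) => [r|//|//] r0; last by rewrite /= leNye.
    rewrite -EFinB lee_fin; have := ler_norm c; rewrite lee_fin in r0; lra.
  by rewrite Ia ltry.
rewrite integralE negoo goo -(fineK posfin) -(fineK mDfin) -EFinM.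
by [].
Qed.

End integral_of_difference.

Section utility.
Context (R : realType) (sigma gamma : R).
Hypotheses (sigma_neq1 : sigma <> 1) (gamma_neq1 : gamma <> 1).

(** For [p < 1] the power increases up to its value at 2; for [p > 1] the
    quotient is negative. *)
Lemma powR_div_le (a p : R) : p <> 1 -> 0 < a <= 2 ->
  a `^ (1 - p) / (1 - p) <= Num.max 1 (2 `^ (1 - p)) / `|1 - p|.
Proof.
move=> p1 /andP[a0 a2].
have p0 : 1 - p != 0 by rewrite subr_eq0; apply/eqP => /esym.
have n0 : 0 < `|1 - p| by rewrite normr_gt0.
have [pp|pp] := ltP 0 (1 - p).
  rewrite gtr0_norm// ler_pM2r ?invr_gt0// le_max; apply/orP; right.
  by apply: ge0_ler_powR; rewrite ?nnegrE; lra.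
apply: (@le_trans _ _ 0).
  by rewrite mulr_ge0_le0 ?powR_ge0// invr_le0.
by rewrite divr_ge0// le_max ler01.
Qed.

Definition utility_bound : R :=
  Num.max 1 (2 `^ (1 - sigma)) / `|1 - sigma| +
  Num.max 1 (2 `^ (1 - gamma)) / `|1 - gamma|.

Lemma utility_le (y : R) : 0 < y < 1 -> U sigma gamma y <= utility_bound.
Proof.
move=> /andP[y0 y1]; rewrite /U (min_idPr (ltW y1)).
by apply: lerD; apply: powR_div_le => //; apply/andP; split; lra.
Qed.

Lemma measurable_utility : measurable_fun setT (U sigma gamma).
Proof.
have mmin : measurable_fun setT (fun y : R => Num.min 1 y).
  exact: measurable_minr.
apply: measurable_funD; apply: measurable_funM => //.
  exact: (measurableT_comp (measurable_powR (1 - sigma)) mmin).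
apply: (measurableT_comp (measurable_powR (1 - gamma))).
exact: measurable_funB.
Qed.

End utility.

Section geometric_ereal.
Local Open Scope ereal_scope.
Context (R : realType) (beta : R).
Hypothesis beta01 : (0 < beta < 1)%R.

Lemma cvg_geometric_sum (c : R) :
  \sum_(0 <= i < n) (beta ^+ i * c)%:E @[n --> \oo] --> ((1 - beta)^-1 * c)%:E.
Proof.
rewrite (_ : (fun n => _) = EFin \o series (geometric c beta)); last first.
  apply/funext => n; rewrite sumEFin /=; congr (_%:E).
  by apply: eq_bigr => i _; rewrite mulrC.
apply: cvg_EFin; first exact: nearW.
rewrite mulrC; apply: cvg_geometric_series.
by case/andP: beta01 => b0 b1; rewrite gtr0_norm.
Qed.

Lemma geometric_nneseries (I : \bar R) : 0 <= I ->
  \sum_(0 <= i <oo) (beta ^+ i)%:E * I = ((1 - beta)^-1)%:E * I.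
Proof.
case/andP: beta01 => b0 b1.
have bi i : (0 <= beta ^+ i)%R by rewrite exprn_ge0// ltW.
move=> I0; have [->|Ioo] := eqVneq I +oo; last first.
  have If : I \is a fin_num by rewrite ge0_fin_numE// ltey.
  apply/cvg_lim => //; rewrite -(fineK If) -EFinM.
  rewrite (_ : (fun n => _) = (fun n =>
    \sum_(0 <= i < n) (beta ^+ i * fine I)%:E)); last first.
    by apply/funext => n; apply: eq_bigr => i _; rewrite EFinM.
  exact: cvg_geometric_sum.
have pinv : (0 < (1 - beta)^-1)%R by rewrite invr_gt0 subr_gt0.
rewrite [RHS]gt0_muley ?lte_fin//.
apply/eqP; rewrite -leye_eq.
have := @nneseries_lim_ge R (fun i => (beta ^+ i)%:E * +oo) xpredT 0%N 1%N.
rewrite big_nat1 expr0 mul1e; apply => i _ _.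
by apply: mule_ge0 => //; rewrite lee_fin.
Qed.

End geometric_ereal.

Lemma ge0_integral_same_law (d1 d2 : measure_display) (X1 : measurableType d1)
    (X2 : measurableType d2) (R : realType) (m1 : probability X1 R)
    (m2 : probability X2 R) (phi1 : X1 -> R) (phi2 : X2 -> R)
    (D : set R) (f : R -> \bar R) :
  measurable_fun setT phi1 -> measurable_fun setT phi2 ->
  (forall B, measurable B -> m1 (phi1 @^-1` B) = m2 (phi2 @^-1` B)) ->
  measurable D -> measurable_fun D f -> (forall y, D y -> 0 <= f y)%E ->
  (\int[m1]_(x in phi1 @^-1` D) f (phi1 x) =
   \int[m2]_(x in phi2 @^-1` D) f (phi2 x))%E.
Proof.
move=> mphi1 mphi2 law12 mD mf f0.
have f0' : {in D, forall y, (0 <= f y)%E} by move=> y /set_mem; exact: f0.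
rewrite -[LHS](ge0_integral_pushforward mphi1 m1 mD mf f0').
rewrite -[RHS](ge0_integral_pushforward mphi2 m2 mD mf f0').
apply: eq_measure_integral => // A mA _; exact: law12.
Qed.

(** * The integral of the utility function *)

Section utility_integrals.
Local Open Scope ereal_scope.
Context (R : realType) (nu beta sigma gamma : R).
Hypotheses (nu_gt4 : (4 < nu)%R) (beta01 : (0 < beta < 1)%R).
Hypotheses (sigma_neq1 : sigma <> 1%R) (gamma_neq1 : gamma <> 1%R).
Context (J : bool -> set R) (branchJ : branch_intervals nu J).
Context (mu0 : probability (borel (hLambda nu)) R).
Hypothesis mu0_max : maximal_entropy_measure mu0 (@hshift R nu).
Context (mu : probability (borel cantor_space) R).
Hypothesis mu_max : maximal_entropy_measure mu shift2.

Local Notation Us := (U sigma gamma).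
Local Notation C := (utility_bound sigma gamma).
Local Notation inner := (`]0%R, 1%R[%classic : set R).
Local Notation hinv := (itinerary_inv nu J).

Let inner_set i : set (borel (hLambda nu)) := [set x | inner (hcoord x i)].

(** If [x_{-i-1}] were 0 or 1, then [x_{-i}] would be 0. *)
Lemma inner_hcoord (x : hLambda nu) :
  (forall i, 0 < hcoord x i < 1)%R <-> (0 < hcoord x 0 < 1)%R.
Proof.
split=> [|x0]; first exact.
elim=> // i /andP[h0 h1].
have /andP[k0 k1] := Lambda_itv (hcoord_Lambda x i.+1).
move: h0; rewrite -hcoordS /logistic => h0; rewrite !lt_neqAle k0 k1 !andbT.
apply/andP; split; apply/eqP => e; move: h0.
  by rewrite -e mulr0 mul0r ltxx.
by rewrite e subrr mulr0 ltxx.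
Qed.

Lemma measurable_inner_set i : measurable (inner_set i).
Proof.
rewrite -[X in measurable X]setTI.
exact: (measurable_hcoord nu_gt4 branchJ i measurableT (measurable_itv _)).
Qed.

Let V (y : R) : \bar R := (C - Us y)%:E.

Lemma measurable_V : measurable_fun setT V.
Proof.
apply/measurable_EFinP; apply: measurable_funB => //.
exact: measurable_utility.
Qed.

Lemma V_ge0 y : inner y -> 0 <= V y.
Proof. by rewrite /= in_itv/= => /utility_le uy; rewrite lee_fin subr_ge0 uy. Qed.

Let I0 := \int[mu0]_(x in inner_set 0) V (hcoord x 0).

Lemma I0_ge0 : 0 <= I0.
Proof. by apply: integral_ge0 => x x0; exact: V_ge0. Qed.

(** The set where [x_0] lies in (0, 1) is contained in the one where
    [x_{-i}] does, and they have the same mass, so that the domain can be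
    enlarged to the one matching the integrand. *)
Lemma integral_hcoord i : \int[mu0]_(x in inner_set 0) V (hcoord x i) = I0.
Proof.
have mi := measurable_hcoord nu_gt4 branchJ.
have minner : measurable inner by exact: measurable_itv.
have sub : inner_set 0 `<=` inner_set i.
  move=> x; rewrite /inner_set/= !in_itv/= => x0.
  exact: (proj2 (inner_hcoord x) x0 i).
have N0 : mu0 (inner_set i `\` inner_set 0) = 0.
  have e : mu0 (inner_set i) = mu0 (inner_set 0).
    exact: (law_hcoord nu_gt4 branchJ mu0_max i minner).
  rewrite measureD; [|exact: measurable_inner_set..|].
    rewrite setIidr//; transitivity (mu0 (inner_set 0) - mu0 (inner_set 0)).
      by congr (_ - _); exact: e.
    by rewrite subee//; apply: fin_num_measure; exact: measurable_inner_set.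
  by rewrite (le_lt_trans (probability_le1 _ _)) ?ltry//; exact: measurable_inner_set.
have -> : \int[mu0]_(x in inner_set 0) V (hcoord x i) =
          \int[mu0]_(x in inner_set i) V (hcoord x i).
  rewrite [RHS](ge0_negligible_integral (N := inner_set i `\` inner_set 0))//.
  - by rewrite setDD setIidr.
  - by apply: measurableD; exact: measurable_inner_set.
  - exact: measurable_inner_set.
  - by apply: measurable_funTS; exact: (measurableT_comp measurable_V (mi i)).
  - by move=> x; exact: V_ge0.
apply: (@ge0_integral_same_law _ _ (borel (hLambda nu)) (borel (hLambda nu)) R
  mu0 mu0 (fun x => hcoord x i) (fun x => hcoord x 0) inner V (mi i) (mi 0%N)) => //.
- by move=> B mB; exact: (law_hcoord nu_gt4 branchJ mu0_max i mB).
- exact: measurable_funTS measurable_V.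
- exact: V_ge0.
Qed.

Lemma integral_itinerary_inv :
  \int[mu]_(s in hinv @^-1` inner) V (hinv s) = I0.
Proof.
have minner : measurable inner by exact: measurable_itv.
have mh := measurable_itinerary_inv nu_gt4 branchJ.
apply: (@ge0_integral_same_law _ _ (borel cantor_space) (borel (hLambda nu)) R
  mu mu0 hinv (fun x => hcoord x 0) inner V mh
  (measurable_hcoord nu_gt4 branchJ 0)) => //.
- by move=> B mB; exact: (law_itinerary_inv nu_gt4 branchJ mu0_max mu_max mB).
- exact: measurable_funTS measurable_V.
- exact: V_ge0.
Qed.

Let S (x : hLambda nu) := \sum_(0 <= i <oo) (beta ^+ i)%:E * V (hcoord x i).

(** The partial sums of [W] are those of a geometric series minus those of a
    series with nonnegative terms; the former converges to a finite value, so
    the limits subtract even if the latter diverges. *)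
Lemma W_split (x : hLambda nu) : inner_set 0 x ->
  W beta sigma gamma x = ((1 - beta)^-1 * C)%:E - S x.
Proof.
move=> x0; apply/cvg_lim => //.
have Vi i : 0 <= (beta ^+ i)%:E * V (hcoord x i).
  have /andP[b0 _] := beta01.
  apply: mule_ge0; first by rewrite lee_fin exprn_ge0// ltW.
  apply: V_ge0; move: x0; rewrite /inner_set/= !in_itv/= => x0.
  exact: (proj2 (inner_hcoord x) x0 i).
rewrite (_ : (fun n => _) = (fun n => \sum_(0 <= i < n) (beta ^+ i * C)%:E -
    \sum_(0 <= i < n) (beta ^+ i)%:E * V (hcoord x i))); last first.
  apply/funext => n; rewrite /V.
  under [X in _ = _ - X]eq_bigr do rewrite -EFinM.
  rewrite !sumEFin -EFinB -sumrB; congr (_%:E); apply: eq_bigr => i _.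
  by rewrite mulrBr opprB addrCA subrr addr0.
apply: cvgeB; first exact: fin_num_adde_defr.
  exact: cvg_geometric_sum.
by apply: is_cvg_nneseries => n _ _.
Qed.

(** Both sides are computed as a constant minus a multiple of [I0]; the masses
    of the two domains agree by [law_itinerary_inv]. *)
Lemma integral_W :
  \int[mu0]_(x in [set x : hLambda nu | forall i, (0 < hcoord x i < 1)%R])
     W beta sigma gamma x
   = ((1 - beta)^-1)%:E *
     \int[mu]_(s in [set s | (0 < hinv s < 1)%R]) (Us (hinv s))%:E.
Proof.
have [b0 b1] := andP beta01.
have minner : measurable inner by exact: measurable_itv.
have mS0 := measurable_inner_set 0.
have -> : [set x : hLambda nu | forall i, (0 < hcoord x i < 1)%R] = inner_set 0.
  apply/seteqP; split=> x; rewrite /inner_set/= in_itv/=; first exact.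
  by move=> /(proj2 (inner_hcoord x)).
have -> : [set s | (0 < hinv s < 1)%R] = hinv @^-1` inner.
  by apply/seteqP; split=> s; rewrite /preimage/= in_itv.
have Vi i x : inner_set 0 x -> 0 <= V (hcoord x i).
  rewrite /inner_set/= in_itv/= => x0; apply: V_ge0; rewrite /= in_itv/=.
  exact: (proj2 (inner_hcoord x) x0 i).
have bi i : 0 <= (beta ^+ i)%:E by rewrite lee_fin exprn_ge0// ltW.
have mV i : measurable_fun setT (fun x : borel (hLambda nu) => V (hcoord x i)).
  exact: (measurableT_comp measurable_V (measurable_hcoord nu_gt4 branchJ i)).
have mbV i : measurable_fun (inner_set 0)
    (fun x : borel (hLambda nu) => (beta ^+ i)%:E * V (hcoord x i)).
  by apply: measurable_funTS; apply: emeasurable_funM => //; exact: measurable_cst.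
have mS : measurable_fun (inner_set 0) (S : borel (hLambda nu) -> \bar R).
  apply: (ge0_emeasurable_sum (P := xpredT)) => // i x x0 _.
  by apply: mule_ge0 => //; exact: Vi.
rewrite (eq_integral (fun x : borel (hLambda nu) => ((1 - beta)^-1 * C)%:E - S x)); last first.
  by move=> x /set_mem; exact: W_split.
rewrite (@integral_cst_sub _ _ _ mu0 _ _ _ mS0 mS); last first.
  by move=> x x0; apply: nneseries_ge0 => i _ _; apply: mule_ge0 => //; exact: Vi.
have -> : \int[mu0]_(x in inner_set 0) S x = ((1 - beta)^-1)%:E * I0.
  rewrite integral_nneseries//; last first.
    by move=> i x x0; apply: mule_ge0 => //; exact: Vi.
  rewrite -(geometric_nneseries beta01 I0_ge0); apply: eq_eseriesr => i _.
  rewrite -(integral_hcoord i).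
  exact: (@ge0_integralZl _ _ R mu0 _ mS0 (fun x : borel (hLambda nu) => V (hcoord x i))
    (measurable_funTS (mV i)) _ (Vi i) (bi i)).
have mhi : measurable (hinv @^-1` inner : set (borel cantor_space)).
  rewrite -[X in measurable X]setTI.
  exact: (measurable_itinerary_inv nu_gt4 branchJ measurableT minner).
rewrite (eq_integral (fun s : borel cantor_space => C%:E - V (hinv s))); last first.
  by move=> s _; rewrite /V -EFinB subKr.
rewrite (@integral_cst_sub _ _ _ mu _ (fun s => V (hinv s)) _ mhi); last 2 first.
- apply: measurable_funTS.
  exact: (measurableT_comp measurable_V (measurable_itinerary_inv nu_gt4 branchJ)).
- by move=> s; exact: V_ge0.
rewrite integral_itinerary_inv.
have -> : mu (hinv @^-1` inner) = mu0 (inner_set 0).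
  exact: (law_itinerary_inv nu_gt4 branchJ mu0_max mu_max minner).
have finC : C%:E * mu0 (inner_set 0) \is a fin_num.
  by apply: fin_numM => //; apply: fin_num_measure; exact: mS0.
rewrite (@muleBr _ _ _ I0 _ (@fin_num_adde_defr _ _ (- I0) finC))//.
by rewrite EFinM muleA.
Qed.

End utility_integrals.

Theorem corollary1 (R : realType) (nu beta sigma gamma : R)
  (nu_gt4 : 4 < nu)
  (beta_gt0 : 0 < beta) (beta_lt1 : beta < 1)
  (sigma_gt0 : 0 < sigma) (sigma_neq1 : sigma <> 1)
  (gamma_gt0 : 0 < gamma) (gamma_neq1 : gamma <> 1)
  (J : bool -> set R) (branchJ : branch_intervals nu J)
  (mu0 : probability (borel (hLambda nu)) R)
  (mu0_max : maximal_entropy_measure mu0 (@hshift R nu))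
  (mu : probability (borel cantor_space) R)
  (mu_max : maximal_entropy_measure mu shift2) :
  [/\ logistic nu @` Lambda nu = Lambda nu,
      cantor_like (Lambda nu) &
      (\int[mu0]_(x in [set x : hLambda nu | forall i, (0 < hcoord x i < 1)%R])
         W beta sigma gamma x
       = ((1 - beta)^-1)%:E *
         \int[mu]_(s in [set s | (0 < itinerary_inv nu J s < 1)%R])
           (U sigma gamma (itinerary_inv nu J s))%:E)%E].
Proof.
split; first exact: logistic_Lambda_onto.
  exact: (cantor_like_Lambda nu_gt4 branchJ).
by apply: integral_W => //; rewrite beta_gt0.
Qed.
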